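(* Let $w\in W$. Then $$\mathrm{EQB}(w)=\bigl\{u\in W\ \big|\ \text{there does not exist } z\in W\text{ such that } z>w\text{ and } z\le_w u\bigr\}.$$
   Context: $W=\langle s_i\mid i\in I\rangle$ is the Weyl group of a finite-dimensional simple Lie algebra over $\mathbb C$, with simple roots $\alpha_i$ ($i\in I$), positive roots $\Delta^+$, coroots $\beta^\vee$, length function $\ell$, longest element $w_\circ$; $\rho=\frac12\sum_{\alpha\in\Delta^+}\alpha$; $>$ is the Bruhat order on $W$. The quantum Bruhat graph $\mathrm{QBG}(W)$ is the $\Delta^+$-labeled directed graph with vertex set $W$ and directed edges $u\xrightarrow{\beta}v$, $\beta\in\Delta^+$, $v=us_\beta$, such that either $\ell(v)=\ell(u)+1$ or $\ell(v)=\ell(u)+1-2\langle\rho,\beta^\vee\rangle$. For any $u,v\in W$ there is a directed path from $u$ to $v$; $\ell(u\Rightarrow v)$ is the length of a shortest one. The $w$-tilted Bruhat order is defined by: $u\le_w v$ iff $\ell(w\Rightarrow v)=\ell(w\Rightarrow u)+\ell(u\Rightarrow v)$. Definition of $\mathrm{EQB}(w)$: fix a reduced expression $w=s_{i_1}\cdots s_{i_p}$ and choose $i_{-m},\dots,i_0\in I$ such that $s_{i_{-m}}\cdots s_{i_0}s_{i_1}\cdots s_{i_p}$ is a reduced expression for $w_\circ$. Put $\beta_k=s_{i_p}\cdots s_{i_{k+1}}\alpha_{i_k}\in\Delta^+$ for $-m\le k\le p$ (these exhaust $\Delta^+$ and $\beta_{-m}<\cdots<\beta_p$ is a reflection order).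 For each $u\in W$ there is a unique shortest directed path $w=x_0\xrightarrow{\beta_{j_1}}x_1\xrightarrow{\beta_{j_2}}\cdots\xrightarrow{\beta_{j_s}}x_s=u$ in $\mathrm{QBG}(W)$ with $-m\le j_1<j_2<\cdots<j_s\le p$ (the label-increasing path). $\mathrm{EQB}(w)$ is the set of all $u\in W$ whose label-increasing path from $w$ satisfies $j_1\ge1$ (vacuous if $u=w$); it does not depend on the choice of the reduced expression of $w$. *)

(* Defs.v *)
From HB Require Import structures.
From mathcomp Require Import all_boot all_order all_algebra all_fingroup.
Set Implicit Arguments.
Unset Strict Implicit.
Unset Printing Implicit Defensive.
Import Order.TTheory GRing.Theory Num.Theory.
Local Open Scope ring_scope.

(* <x, a^vee> = 2 (x, a) / (a, a). *)
Definition coroot_pairing (R : realFieldType) (V : vectType R)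
    (form : V -> V -> R) (x a : V) : R := 2 * form x a / form a a.

Definition reflection (R : realFieldType) (V : vectType R)
    (form : V -> V -> R) (a x : V) : V := x - coroot_pairing form x a *: a.

(* A nonempty irreducible reduced crystallographic root system in a Euclidean
   space over R, together with a choice of simple roots.  By the
   Killing-Cartan classification these are exactly the root systems (with
   base) of the finite-dimensional simple complex Lie algebras. *)
Record root_system (R : realFieldType) (V : vectType R) (n : nat) :=
  RootSystem {
  form : V -> V -> R;
  form_linearl : forall c x y z,
    form (c *: x + y) z = c * form x z + form y z;
  form_sym : forall x y, form x y = form y x;
  form_pos : forall x, x != 0 -> 0 < form x x;
  roots : seq V;
  roots_nonempty : roots != [::];
  roots_neq0 : 0 \notin roots;
  roots_reflection : forall a b,
    a \in roots -> b \in roots -> reflection form a b \in roots;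
  roots_integral : forall a b, a \in roots -> b \in roots ->
    exists m : int, coroot_pairing form b a = m%:~R;
  roots_reduced : forall a c,
    a \in roots -> c *: a \in roots -> c = 1 \/ c = -1;
  roots_irreducible : forall P : pred V,
    (forall a b, a \in roots -> b \in roots -> P a -> ~~ P b ->
       form a b = 0) ->
    (forall a, a \in roots -> P a) \/ (forall a, a \in roots -> ~~ P a);
  simple_roots : n.-tuple V;
  simple_basis : basis_of fullv simple_roots;
  simple_in_roots : forall i, tnth simple_roots i \in roots;
  roots_simple_sum : forall b, b \in roots -> exists c : 'I_n -> nat,
    b = \sum_i (c i)%:R *: tnth simple_roots i \/
    b = - \sum_i (c i)%:R *: tnth simple_roots i }.

Definition rootT (R : realFieldType) (V : vectType R) (n : nat)
    (Phi : root_system V n) : finType := seq_sub (roots Phi).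

Definition simple_root (R : realFieldType) (V : vectType R) (n : nat)
    (Phi : root_system V n) (i : 'I_n) : rootT Phi :=
  SeqSub (simple_in_roots Phi i).

Definition pairing (R : realFieldType) (V : vectType R) (n : nat)
    (Phi : root_system V n) (x : V) (a : rootT Phi) : R :=
  coroot_pairing (form Phi) x (val a).

Definition positive (R : realFieldType) (V : vectType R) (n : nat)
    (Phi : root_system V n) (a : rootT Phi) : bool :=
  [forall i, 0 <= coord (simple_roots Phi) i (val a)].

Definition rho (R : realFieldType) (V : vectType R) (n : nat)
    (Phi : root_system V n) : V :=
  2^-1 *: \sum_(a : rootT Phi | positive a) val a.

Definition root_refl (R : realFieldType) (V : vectType R) (n : nat)
    (Phi : root_system V n) (a b : rootT Phi) : rootT Phi :=
  SeqSub (roots_reflection (valP a) (valP b)).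

Lemma root_reflK (R : realFieldType) (V : vectType R) (n : nat)
  (Phi : root_system V n) (a : rootT Phi) : involutive (root_refl a).
Proof.
move=> b; apply: val_inj => /=.
have a0 : form Phi (val a) (val a) != 0.
  rewrite gt_eqF // form_pos //; apply: contraNneq (roots_neq0 Phi) => <-.
  exact: valP.
rewrite /reflection /coroot_pairing.
set k := 2 * _ / _.
have -> : form Phi (val b - k *: val a) (val a) =
          - k * form Phi (val a) (val a) + form Phi (val b) (val a).
  by rewrite -form_linearl scaleNr addrC.
have -> : 2 * (- k * form Phi (val a) (val a) + form Phi (val b) (val a))
          / form Phi (val a) (val a) = - k.
  rewrite mulrDr mulrDl mulrA mulfK // -/k mulrN mulr_natl mulr2n opprD.
  by rewrite addrNK.
by rewrite scaleNr opprK addrNK.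
Qed.

Definition root_perm (R : realFieldType) (V : vectType R) (n : nat)
    (Phi : root_system V n) (a : rootT Phi) : {perm rootT Phi} :=
  perm (can_inj (root_reflK a)).

(* The Weyl group <s_i | i in I>, acting faithfully on the roots.  The product
   u * v of permutations applies u first, so an element s_{i_1} * ... * s_{i_p}
   of this group acts on roots as the inverse of s_{i_1} ... s_{i_p} does in
   the usual left action; as inversion fixes every reflection, expressions of
   elements as products of reflections read exactly as usual. *)
Definition weyl (R : realFieldType) (V : vectType R) (n : nat)
    (Phi : root_system V n) : {group {perm rootT Phi}} :=
  (<<[set root_perm (simple_root Phi i) | i : 'I_n]>>)%G.

Definition word_prod (R : realFieldType) (V : vectType R) (n : nat)
    (Phi : root_system V n) (s : seq 'I_n) : {perm rootT Phi} :=
  (\prod_(i <- s) root_perm (simple_root Phi i))%g.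

(* A shortest word for an element of W is shorter than #|W|, as its prefixes
   have distinct products; the bound only serves to make the minimum finite. *)
Definition len (R : realFieldType) (V : vectType R) (n : nat)
    (Phi : root_system V n) (u : {perm rootT Phi}) : nat :=
  \big[minn/#|weyl Phi|]_(k < #|weyl Phi|
     | [exists s : k.-tuple 'I_n, word_prod Phi s == u]) k.

Definition reduced_expr (R : realFieldType) (V : vectType R) (n : nat)
    (Phi : root_system V n) (s : seq 'I_n) (u : {perm rootT Phi}) : bool :=
  (word_prod Phi s == u) && (size s == len u).

Definition longest (R : realFieldType) (V : vectType R) (n : nat)
    (Phi : root_system V n) : {perm rootT Phi} :=
  [arg max_(u > 1%g in weyl Phi) len u].

Definition bruhat_lt (R : realFieldType) (V : vectType R) (n : nat)
    (Phi : root_system V n) (u v : {perm rootT Phi}) : bool :=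
  (u != v) &&
  connect (fun x y => [exists a : rootT Phi,
                         (y == x * root_perm a)%g && (len x < len y)%N]) u v.

Definition qbg_edge (R : realFieldType) (V : vectType R) (n : nat)
    (Phi : root_system V n) (u : {perm rootT Phi}) (a : rootT Phi)
    (v : {perm rootT Phi}) : bool :=
  [&& positive a, v == (u * root_perm a)%g &
      (len v == (len u).+1) ||
      ((len v)%:R == (len u)%:R + 1 - 2 * pairing (rho Phi) a)].

(* A directed path from u to v, given by its sequence of labels (which
   determines its vertices). *)
Fixpoint qbg_path (R : realFieldType) (V : vectType R) (n : nat)
    (Phi : root_system V n) (u : {perm rootT Phi}) (p : seq (rootT Phi))
    (v : {perm rootT Phi}) : bool :=
  if p is a :: p' then
    qbg_edge u a (u * root_perm a)%g && qbg_path (u * root_perm a)%g p' v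
  else u == v.

(* The bound is harmless: a shortest path visits no vertex of W twice. *)
Definition qbg_dist (R : realFieldType) (V : vectType R) (n : nat)
    (Phi : root_system V n) (u v : {perm rootT Phi}) : nat :=
  \big[minn/#|weyl Phi|]_(k < #|weyl Phi|
     | [exists p : k.-tuple (rootT Phi), qbg_path u p v]) k.

Definition tilted_le (R : realFieldType) (V : vectType R) (n : nat)
    (Phi : root_system V n) (w u v : {perm rootT Phi}) : bool :=
  qbg_dist w v == (qbg_dist w u + qbg_dist u v)%N.

(* For s = [:: i_1; ...; i_N] (here k counts from 0), the root
   s_{i_N} ... s_{i_{k+1}} alpha_{i_k} for the usual left action, so that
   s_{i_{k+1}} is applied first. *)
Definition beta (R : realFieldType) (V : vectType R) (n : nat)
    (Phi : root_system V n) (s : seq 'I_n) (k : 'I_(size s)) : rootT Phi :=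
  foldl (fun x j => root_refl (simple_root Phi j) x)
        (simple_root Phi (tnth (in_tuple s) k)) (drop k.+1 s).

(* A strictly increasing sequence j_1 < ... < j_r of positions is encoded as
   the set J of its entries, which enum lists in increasing order. *)
Definition label_increasing_shortest_path (R : realFieldType) (V : vectType R)
    (n : nat) (Phi : root_system V n) (s : seq 'I_n)
    (w u : {perm rootT Phi}) (J : {set 'I_(size s)}) : bool :=
  qbg_path w [seq beta Phi j | j <- enum J] u && (#|J| == qbg_dist w u).

(* b is meant to be a reduced expression of w and a ++ b one of the longest
   element; the positions of b in a ++ b, i.e. those that are at least size a,
   are the indices called 1, ..., p in the usual numbering
   a = s_{i_{-m}} ... s_{i_0}, b = s_{i_1} ... s_{i_p}. *)
Definition EQB (R : realFieldType) (V : vectType R) (n : nat)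
    (Phi : root_system V n) (w : {perm rootT Phi}) (a b : seq 'I_n) :
    {set {perm rootT Phi}} :=
  [set u in weyl Phi |
     [exists J : {set 'I_(size (a ++ b))},
        label_increasing_shortest_path w u J &&
        [forall j in J, (size a <= j)%N]]].

(* Main.v *)
From mathcomp Require Import all_boot all_order all_algebra all_fingroup.
From mathcomp Require Import ring lra zify.
Require Import Defs.
Set Implicit Arguments.
Unset Strict Implicit.
Unset Printing Implicit Defensive.
Import Order.TTheory GRing.Theory Num.Theory.

(** Fix a reduced word [a ++ b] of the longest element, where [b] spells
    [w], and the reflection order it defines. The core is that any two
    elements of [W] are joined by exactly one label-increasing walk in the
    quantum Bruhat graph, and that this walk is shortest ([unique_qwalk]).

    For the core, call a root [a] affine simple if it is simple or the
    lowest root, and say that [x] is on the positive side of the wall of [a]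
    if the root [x a] is positive; as products of permutations are read from
    left to right, [x a] is what the inverse of [x] does to [a] in the usual
    left action. Left multiplication by the reflection in [a] exchanges the
    sides and keeps edge labels. Edges that stay on one side have mirror
    images, and from the positive to the negative side there is just one
    edge at [x], labelled [x a] ([affine_wall]). So if [x] is on the
    positive and [y] on the negative side, removing the first crossing turns
    walks from [x] to [y] into walks from the mirror image of [x] to [y],
    which are shorter by 1; on increasing walks this is a bijection, as
    convexity of the reflection order leaves exactly one place where a
    crossing can be inserted ([unique_increasing_walk_cross]). Crossings at
    the end are removed likewise. Combining both, a pair may also be
    reflected as a whole. The lowest root is what allows these moves to
    continue for ever: going down through walls, one can reach every element
    of [W] from every other ([descend_connect]), hence a wall that separates
    [x] from [y]. All properties of walls come from one equation that is
    satisfied by the affine simple roots ([affine_simple]) and from an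
    equation for the edges in the same terms ([qbg_edgeP]).

    It remains to deduce the theorem. The first label of the increasing walk
    is least among the first labels of all shortest walks
    ([increasing_first_label]). The positive roots made negative by [w^-1]
    are the labels contributed by [b], which come last in the order; so [u]
    is outside [EQB w] if and only if the increasing walk from [w] to [u]
    starts with a label [g] that [w^-1] keeps positive. In this case, its
    first edge goes up in the Bruhat order, to an element [z > w] on a
    shortest walk to [u]. Conversely, let [z > w] be on a shortest walk from
    [w] to [u]. If the increasing walk from [w] to [z] only had labels
    contributed by [b], then it would delete letters from [b] ([deletion])
    and [z] would be shorter than [w]. So it starts with a label that [w^-1]
    keeps positive, and by minimality so does the increasing walk from [w]
    to [u]. *)

(** * Increasing walks in a labelled graph with a wall *)

Section Walks.
Variables (T L : eqType) (act : T -> L -> T).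

Fixpoint walk (E : T -> L -> bool) (x : T) (p : seq L) (y : T) : bool :=
  if p is g :: p' then E x g && walk E (act x g) p' y else x == y.

Lemma walk_cat E x p q y :
  walk E x (p ++ q) y = walk E x p (foldl act x p) && walk E (foldl act x p) q y.
Proof. by elim: p x => [|g p IHp] x /=; rewrite ?eqxx // IHp andbA. Qed.

Lemma walk_end E x p y : walk E x p y -> y = foldl act x p.
Proof.
elim: p x => [|g p IHp] x /=; first by move/eqP.
by case/andP=> _ /IHp.
Qed.

Lemma walk_rcons E x p g y :
  walk E x (rcons p g) y =
    [&& walk E x p (foldl act x p), E (foldl act x p) g &
        act (foldl act x p) g == y].
Proof. by rewrite -cats1 walk_cat /=. Qed.

Lemma walk_rev E x p y : (forall z g, act (act z g) g = z) ->
  walk E x p y = walk (fun z g => E (act z g) g) y (rev p) x.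
Proof.
move=> actK; elim: p x => [|g p IHp] x; first by rewrite /= eq_sym.
rewrite rev_cons walk_rcons /= IHp; apply/idP/idP.
- case/andP=> Exg w; move: (walk_end w) => <-.
  by rewrite w actK Exg eqxx.
by case/and3P=> w Exg /eqP xE; rewrite -xE actK Exg.
Qed.

Definition unique_increasing_walk (E : T -> L -> bool) (lt : rel L) d x y :=
  exists p, [/\ walk E x p y, sorted lt p, size p <= d
     & forall q, walk E x q y -> sorted lt q -> q = p].

(** The axioms of a wall: [s] is the reflection in the wall, [pos] tells the
    sides apart, and [eta x] is the label with which [x] is moved to its mirror
    image [s x].  Edges cross from the positive to the negative side only
    along [eta], and edges that stay on one side have mirror images.  The last
    axiom is what a reflection order has to satisfy: a step labelled [g]
    preserves the comparison of [eta] with [g] if it stays on one side, and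
    reverses it otherwise. *)
Record wall (D : pred T) (E : T -> L -> bool) (ok : pred L) (lt : rel L)
  (pos : pred T) (s : T -> T) (eta : T -> L) : Prop := Wall {
  wall_irr : irreflexive lt;
  wall_trans : transitive lt;
  wall_total : forall g h, ok g -> ok h -> g != h -> lt g h || lt h g;
  wall_actK : forall x g, act (act x g) g = x;
  wall_edge : forall x g, E x g -> D x && ok g;
  wall_oketa : forall x, ok (eta x);
  wall_D : forall x, D (s x) = D x;
  wall_Dact : forall x g, D (act x g) = D x;
  wallK : involutive s;
  wall_pos : forall x, D x -> pos (s x) = ~~ pos x;
  wall_eta : forall x, D x -> eta (s x) = eta x;
  wall_act : forall x g, s (act x g) = act (s x) g;
  wall_act_eta : forall x, D x -> act x (eta x) = s x;
  wall_cross : forall x, D x -> pos x -> E x (eta x);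
  wall_edge_pos : forall x g, pos x -> E x g -> g != eta x ->
    pos (act x g) && E (s x) g;
  wall_edge_neg : forall x g, ~~ pos x -> E x g -> ~~ pos (act x g) -> E (s x) g;
  wall_lt : forall x g, D x -> ok g -> g != eta x ->
    lt (eta (act x g)) g = lt (eta x) g (+) (pos x != pos (act x g)) }.

(** Reversing all edges exchanges the two sides of the wall and turns the
    order around. *)
Lemma wall_dual D E ok lt pos s eta : wall D E ok lt pos s eta ->
  wall D (fun y g => E (act y g) g) ok (fun g h => lt h g) (predC pos) s eta.
Proof.
move=> W; have actK := wall_actK W.
have Dact := wall_Dact W.
split=> //=; try by [exact: wall_irr W | exact: wall_oketa W
  | exact: wall_D W | exact: wallK W | exact: wall_eta W | exact: wall_act W
  | exact: wall_act_eta W].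
- by move=> h g k ltgh lthk; exact: (wall_trans W) lthk ltgh.
- by move=> g h okg okh ne; rewrite orbC (wall_total W).
- by move=> x g /(wall_edge W); rewrite Dact.
- by move=> x Dx; rewrite (wall_pos W).
- move=> x Dx npx; rewrite (wall_act_eta W) // -(wall_eta W) //.
  by apply: (wall_cross W); rewrite ?(wall_D W) // (wall_pos W).
- move=> x g npx Eg neq.
  have Dx : D x by case/andP: (wall_edge W Eg); rewrite Dact.
  case px: (pos (act x g)).
    (* an edge into the negative side from the positive one is labelled eta *)
    case: (eqVneq g (eta (act x g))) => [gE | ne].
      move: (wall_act_eta W (x := act x g)); rewrite Dact -gE actK => /(_ Dx) xE.
      by case/eqP: neq; rewrite xE (wall_eta W) // Dact.
    by case/andP: (wall_edge_pos W px Eg ne); rewrite actK (negPf npx).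
  by rewrite /= -(wall_act W) (wall_edge_neg W) ?px // actK.
- move=> x g; rewrite !negbK => px Eg px'.
  have Dx : D x by case/andP: (wall_edge W Eg); rewrite Dact.
  case: (eqVneq g (eta (act x g))) => [gE | ne].
    move: (wall_pos W (x := act x g)); rewrite Dact => /(_ Dx).
    by rewrite -(wall_act_eta W) ?Dact // -gE actK px' px.
  by case/andP: (wall_edge_pos W px' Eg ne) => _; rewrite (wall_act W).
- move=> x g Dx okg neq.
  have lt_flip h : ok h -> g != h -> lt g h = ~~ lt h g.
    move=> okh ne; case/orP: (wall_total W okg okh ne) => l; rewrite l.
      by apply/esym/negP => l'; move: (wall_trans W l l'); rewrite (wall_irr W).
    by apply/negP => l'; move: (wall_trans W l l'); rewrite (wall_irr W).
  have ne' : g != eta (act x g).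
    apply: contra neq => /eqP gE; apply/eqP.
    move: (wall_act_eta W (x := act x g)); rewrite Dact -gE actK => /(_ Dx) ->.
    by rewrite (wall_eta W) // Dact.
  rewrite !lt_flip ?(wall_oketa W) // (wall_lt W) //.
  by rewrite (inj_eq negb_inj) addNb.
Qed.

Section OneWall.
Variables (D : pred T) (E : T -> L -> bool) (ok : pred L) (lt : rel L).
Variables (pos : pred T) (s : T -> T) (eta : T -> L).
Hypothesis W : wall D E ok lt pos s eta.

(** Once an increasing walk on the positive side has missed its occasion to
    cross, it never crosses: [eta] stays below the later labels. *)
Lemma increasing_walk_stays_pos m x q y : D x -> ok m -> pos x ->
  walk E x q y -> path lt m q -> ~~ lt m (eta x) -> pos y.
Proof.
elim: q m x => [|g q IHq] m x Dx okm px /=; first by move/eqP <-.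
case/andP=> Exg w /andP[ltmg pq] nlt.
case/andP: (wall_edge W Exg) => _ okg.
have Dxg : D (act x g) by rewrite (wall_Dact W).
have ne : g != eta x by apply: contra nlt => /eqP <-.
have ltg : lt (eta x) g.
  case: (eqVneq m (eta x)) => [<- // | nem].
  have := wall_total W okm (wall_oketa W x) nem; rewrite (negPf nlt) /= => l.
  exact: (wall_trans W) l ltmg.
case/andP: (wall_edge_pos W px Exg ne) => pxg _.
apply: (IHq g (act x g)) => //.
apply/negP => l; have := wall_lt W Dx okg ne.
rewrite px pxg ltg /= => l'.
by move: (wall_trans W l l'); rewrite (wall_irr W).
Qed.

(** Removing the first crossing of the wall, and reflecting the part of the
    walk before it. *)
Fixpoint uncross x p := if p is g :: p' then
  if g == eta x then p' else g :: uncross (act x g) p' else [::].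

Lemma uncross_subseq x p : subseq (uncross x p) p.
Proof.
elim: p x => //= g p IHp x.
by case: ifP => _; [exact: subseq_cons | rewrite eqxx].
Qed.

Lemma walk_uncross x p y : D x -> pos x -> ~~ pos y -> walk E x p y ->
  walk E (s x) (uncross x p) y /\ size p = (size (uncross x p)).+1.
Proof.
elim: p x => [|g p IHp] x Dx px npy /=; first by move/eqP => xy; rewrite xy (negPf npy) in px.
case/andP=> Exg w; case: eqP => [gE | /eqP ne] /=.
  by split=> //; rewrite -(wall_act_eta W) // -gE.
case/andP: (wall_edge_pos W px Exg ne) => pxg ->.
have Dxg : D (act x g) by rewrite (wall_Dact W).
by rewrite -(wall_act W); have [-> ->] := IHp _ Dxg pxg npy w.
Qed.

(** An increasing walk can cross at one place at most, so that removing the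
    crossing loses no information. *)
Lemma uncross_inj x p q y : D x -> pos x -> ~~ pos y ->
  walk E x p y -> walk E x q y -> sorted lt p -> sorted lt q ->
  uncross x p = uncross x q -> p = q.
Proof.
have late z g r h r' : D z -> pos z -> ~~ pos y ->
    g = eta z -> walk E z (h :: r') y -> path lt g r -> path lt h r' ->
    h != eta z -> r = h :: uncross (act z h) r' -> False.
  move=> Dz pz npy gE w pr pr' ne rE; case/negP: npy.
  apply: (@increasing_walk_stays_pos g z (h :: r')) => //.
  - by rewrite gE (wall_oketa W).
  - by move: pr; rewrite rE /= => /andP[-> _].
  - by rewrite gE (wall_irr W).
elim: p x q => [|g p IHp] x [|h q] Dx px npy //=.
- by move=> /eqP xy; rewrite xy (negPf npy) in px.
- by move=> _ /eqP xy; rewrite xy (negPf npy) in px.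
move=> wp wq sp sq; move: (wp) (wq) => /andP[Exg w] /andP[Exh w'].
case: eqP => [gE | /eqP gne]; case: eqP => [hE | /eqP hne].
- by rewrite gE hE => ->.
- by move=> pE; case: (late x g p h q).
- by move=> qE; case: (late x h q g p).
case=> gh; rewrite -gh in w' *.
case/andP: (wall_edge_pos W px Exg gne) => pxg _.
have Dxg : D (act x g) by rewrite (wall_Dact W).
by move/(IHp _ _ Dxg pxg npy w w' (path_sorted sp) (path_sorted sq)) => ->.
Qed.

Lemma walk_cross x q y : D x -> pos x -> ~~ pos y ->
  walk E (s x) q y -> sorted lt q ->
  exists p, [/\ walk E x p y, sorted lt p & uncross x p = q].
Proof.
move=> Dx px npy w sq.
suff [p [wp pE sp _]] : exists p, [/\ walk E x p y, uncross x p = q,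
    sorted lt p & forall m, path lt m q -> lt m (eta x) -> path lt m p].
  by exists p.
elim: q x Dx px w sq => [|g q IHq] x Dx px.
  rewrite /= => /eqP sxy _; exists [:: eta x].
  by rewrite /= (wall_cross W) // (wall_act_eta W) // sxy !eqxx; split=> // m _ ->.
move=> wq sq; move: (wq) => /= /andP[Eg w].
case/andP: (wall_edge W Eg) => Dsx okg.
have nps : ~~ pos (s x) by rewrite (wall_pos W) ?px.
case: (eqVneq g (eta x)) => [gE | ne].
  have actx : act (s x) g = x by rewrite gE -(wall_eta W) // (wall_act_eta W) // (wallK W).
  rewrite actx in w; case/negP: npy.
  by apply: (@increasing_walk_stays_pos g x q) => //; rewrite gE (wall_irr W).
case/orP: (wall_total W okg (wall_oketa W x) ne) => [ltg | ltg]; last first.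
  exists [:: eta x, g & q].
  rewrite [walk _ _ _ _]/= (wall_act_eta W) // (wall_cross W) //.
  split=> //=; first by rewrite eqxx.
    by rewrite ltg.
  by move=> m /andP[_ ->] ->; rewrite ltg.
have neta : g != eta (s x) by rewrite (wall_eta W).
have npg : ~~ pos (act (s x) g).
  (* otherwise the walk, back on the positive side, could not return *)
  apply: contra npy => pg.
  apply: (@increasing_walk_stays_pos g (act (s x) g) q) => //;
    first by rewrite (wall_Dact W).
  apply/negP => l; have := wall_lt W Dsx okg neta.
  rewrite pg (negPf nps) (wall_eta W) //=.
  case l2: (lt (eta x) g); first by move: (wall_trans W ltg l2); rewrite (wall_irr W).
  by move=> l3; move: (wall_trans W l l3); rewrite (wall_irr W).
have Exg := wall_edge_neg W nps Eg npg; rewrite (wallK W) in Exg.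
have pxg : pos (act x g) by move: npg; rewrite -(wall_act W) (wall_pos W) ?(wall_Dact W) // negbK.
have Dxg : D (act x g) by rewrite (wall_Dact W).
rewrite -(wall_act W) in w.
have [p [wp pE sp hp]] := IHq _ Dxg pxg w (path_sorted sq).
have pgp : path lt g p.
  apply: hp; first exact: sq.
  have ne' : g != eta (act x g).
    apply: contra ne => /eqP gE.
    move: (wall_act_eta W Dxg); rewrite -gE (wall_actK W) => xE.
    by rewrite gE {2}xE (wall_eta W).
  case/orP: (wall_total W okg (wall_oketa W (act x g)) ne') => // l.
  have := wall_lt W Dx okg ne; rewrite px pxg l /= addbF => l2.
  by move: (wall_trans W ltg (esym l2)); rewrite (wall_irr W).
exists (g :: p); split=> //=.
- by rewrite Exg.
- by rewrite (negPf ne) pE.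
- by move=> m /andP[-> _] _.
Qed.

Lemma unique_increasing_walk_cross d x y : D x -> pos x -> ~~ pos y ->
  unique_increasing_walk E lt d.+1 x y <-> unique_increasing_walk E lt d (s x) y.
Proof.
move=> Dx px npy; have tr := wall_trans W.
have walkp := walk_uncross Dx px npy.
have sort_unc p : sorted lt p -> sorted lt (uncross x p).
  exact: subseq_sorted (uncross_subseq x p).
split=> -[p [wp sp lep up]].
- have [wu sz] := walkp _ wp; exists (uncross x p); split=> //.
  + exact: sort_unc.
  + by rewrite sz ltnS in lep.
  by move=> q wq sq; have [r [wr sr <-]] := walk_cross Dx px npy wq sq; rewrite (up r).
have [r [wr sr rE]] := walk_cross Dx px npy wp sp.
exists r; split=> //; first by rewrite (walkp _ wr).2 rE ltnS.
move=> q wq sq; apply: (uncross_inj Dx px npy) => //.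
by rewrite rE; apply: up; [exact: (walkp _ wq).1 | exact: sort_unc].
Qed.

End OneWall.

Lemma unique_increasing_walk_rev E lt d x y : (forall z g, act (act z g) g = z) ->
  unique_increasing_walk E lt d x y <->
  unique_increasing_walk (fun z g => E (act z g) g) (fun g h => lt h g) d y x.
Proof.
move=> actK; split=> -[p [wp sp lep up]]; exists (rev p);
  rewrite size_rev rev_sorted.
- split=> // [|q wq sq]; first by rewrite -walk_rev.
  by rewrite -[q]revK (up (rev q)) ?rev_sorted // walk_rev // revK.
- split=> // [|q wq sq]; first by rewrite walk_rev // revK.
  by rewrite -[q]revK (up (rev q)) ?rev_sorted // -walk_rev.
Qed.

Lemma unique_increasing_walk_cross_end D E ok lt pos s eta d x y :
  wall D E ok lt pos s eta -> D y -> pos x -> ~~ pos y ->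
  unique_increasing_walk E lt d.+1 x y <-> unique_increasing_walk E lt d x (s y).
Proof.
move=> W Dy px npy; have actK := wall_actK W.
apply: (iff_trans (unique_increasing_walk_rev _ _ _ _ _ actK)).
apply: iff_trans (iff_sym (unique_increasing_walk_rev _ _ _ _ _ actK)).
have px' : ~~ predC pos x by rewrite /= negbK.
exact: (unique_increasing_walk_cross (wall_dual W) d Dy npy px').
Qed.

Lemma walk_cross_end D E ok lt pos s eta x p y :
  wall D E ok lt pos s eta -> D y -> pos x -> ~~ pos y -> walk E x p y ->
  exists2 q, walk E x q (s y) & size p = (size q).+1.
Proof.
move=> W Dy px npy; have actK := wall_actK W; rewrite walk_rev // => w.
have px' : ~~ predC pos x by rewrite /= negbK.
have [w' sz] := walk_uncross (wall_dual W) Dy npy px' w.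
exists (rev (uncross eta y (rev p))); first by rewrite walk_rev // revK.
by rewrite -[LHS]size_rev sz size_rev.
Qed.

End Walks.

(** * Roots, heights and coroot pairings *)

Section RootSystem.
Local Open Scope ring_scope.
Variables (R : realFieldType) (V : vectType R) (n : nat).
Variable Phi : root_system V n.
Local Notation root := (rootT Phi).
Local Notation fm := (form Phi).
Local Notation co := (coord (simple_roots Phi)).
Local Notation simple := (simple_root Phi).
Implicit Types (a b c g t : root) (u v : V) (i j : 'I_n).

Lemma formDl u v z : fm (u + v) z = fm u z + fm v z.
Proof. by rewrite -[u]scale1r form_linearl mul1r scale1r. Qed.

Lemma form0l z : fm 0 z = 0.
Proof. by apply: (addrI (fm 0 z)); rewrite -formDl !addr0. Qed.

Lemma formZl k v z : fm (k *: v) z = k * fm v z.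
Proof. by rewrite -[k *: v]addr0 form_linearl form0l addr0. Qed.

Lemma formNl v z : fm (- v) z = - fm v z.
Proof. by rewrite -scaleN1r formZl mulN1r. Qed.

Lemma formBl u v z : fm (u - v) z = fm u z - fm v z.
Proof. by rewrite formDl formNl. Qed.

Lemma form_suml (I : finType) (F : I -> V) z : fm (\sum_i F i) z = \sum_i fm (F i) z.
Proof. by apply: (big_morph (fm^~ z)); [move=> u v; rewrite formDl | exact: form0l]. Qed.

Lemma formZr k v z : fm z (k *: v) = k * fm z v.
Proof. by rewrite !(form_sym _ z) formZl. Qed.

Lemma formBr u v z : fm z (u - v) = fm z u - fm z v.
Proof. by rewrite !(form_sym _ z) formBl. Qed.

Lemma root_neq0 a : val a != 0.
Proof. by apply: contraNneq (roots_neq0 Phi) => <-; exact: valP. Qed.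

Lemma form_root_gt0 a : 0 < fm (val a) (val a).
Proof. exact: form_pos (root_neq0 a). Qed.

Lemma pairingE v a : pairing v a = 2 * fm v (val a) / fm (val a) (val a).
Proof. by []. Qed.

Lemma pairingD u v a : pairing (u + v) a = pairing u a + pairing v a.
Proof. by rewrite !pairingE formDl mulrDr mulrDl. Qed.

Lemma pairingZ k v a : pairing (k *: v) a = k * pairing v a.
Proof. by rewrite !pairingE formZl; ring. Qed.

Lemma pairingN v a : pairing (- v) a = - pairing v a.
Proof. by rewrite -scaleN1r pairingZ mulN1r. Qed.

Lemma pairingB u v a : pairing (u - v) a = pairing u a - pairing v a.
Proof. by rewrite pairingD pairingN. Qed.

Lemma pairing_self a : pairing (val a) a = 2.
Proof. by rewrite pairingE mulfK // gt_eqF // form_root_gt0. Qed.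

Lemma pairing_gt0 v a : (0 < pairing v a) = (0 < fm v (val a)).
Proof.
by rewrite pairingE mulrAC pmulr_rgt0 // divr_gt0 // form_root_gt0.
Qed.

Lemma pairing_gt0C a b : (0 < pairing (val a) b) = (0 < pairing (val b) a).
Proof. by rewrite !pairing_gt0 form_sym. Qed.

Lemma pairing_ge0 v a : (0 <= pairing v a) = (0 <= fm v (val a)).
Proof.
by rewrite pairingE mulrAC pmulr_rge0 // divr_gt0 // form_root_gt0.
Qed.

Lemma pairing_ge0C a b : (0 <= pairing (val a) b) = (0 <= pairing (val b) a).
Proof. by rewrite !pairing_ge0 form_sym. Qed.

Lemma pairing_int a b : exists m : int, pairing (val a) b = m%:~R.
Proof. by apply: (@roots_integral _ _ _ Phi (val b) (val a)); exact: valP. Qed.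

Lemma pairing_ge1 a b : 0 < pairing (val a) b -> 1 <= pairing (val a) b.
Proof. by have [m ->] := pairing_int a b; rewrite ltr0z ler1z. Qed.

Lemma val_refl a b : val (root_refl a b) = val b - pairing (val b) a *: val a.
Proof. by []. Qed.

Definition ropp a := root_refl a a.

Lemma val_ropp a : val (ropp a) = - val a.
Proof. by rewrite val_refl pairing_self scaler_nat mulr2n opprD addNKr. Qed.

Lemma roppK : involutive ropp.
Proof. by move=> a; apply: val_inj; rewrite !val_ropp opprK. Qed.

Lemma refl_oppr a b : root_refl a (ropp b) = ropp (root_refl a b).
Proof.
by apply: val_inj; rewrite val_ropp 2!val_refl val_ropp pairingN scaleNr opprD.
Qed.

Lemma pairing_oppr v a : pairing v (ropp a) = - pairing v a.
Proof.
rewrite !pairingE val_ropp !(form_sym _ _ (- val a)) !formNl.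
by rewrite (form_sym _ _ (- val a)) formNl opprK (form_sym _ (val a)) mulrN mulNr.
Qed.

Lemma refl_oppl a b : root_refl (ropp a) b = root_refl a b.
Proof.
by apply: val_inj; rewrite 2!val_refl pairing_oppr val_ropp scaleNr scalerN opprK.
Qed.

Lemma refl_self a : root_refl a a = ropp a. Proof. by []. Qed.

(** The height, as a linear form: it turns positivity of a root into the sign
    of a number, so that positive combinations need no case analysis. *)
Definition ht v := \sum_i co i v.

Lemma htD u v : ht (u + v) = ht u + ht v.
Proof. by rewrite /ht -big_split; apply: eq_bigr => i _; rewrite linearD. Qed.

Lemma htZ k v : ht (k *: v) = k * ht v.
Proof. by rewrite /ht mulr_sumr; apply: eq_bigr => i _; rewrite linearZ. Qed.

Lemma htN v : ht (- v) = - ht v.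
Proof. by rewrite -scaleN1r htZ mulN1r. Qed.

Lemma htB u v : ht (u - v) = ht u - ht v.
Proof. by rewrite htD htN. Qed.

Lemma val_simple i : val (simple i) = (simple_roots Phi)`_i.
Proof. by rewrite /= (tnth_nth 0). Qed.

Lemma coordE v : v = \sum_i co i v *: val (simple i).
Proof.
rewrite {1}(coord_basis (simple_basis Phi) (memvf v)).
by apply: eq_bigr => i _; rewrite val_simple.
Qed.

Lemma coord_simple i j : co i (val (simple j)) = (i == j)%:R.
Proof.
rewrite val_simple coord_free 1?eq_sym //.
exact: basis_free (simple_basis Phi).
Qed.

Lemma coord_sum i (c : 'I_n -> nat) :
  co i (\sum_j (c j)%:R *: val (simple j)) = (c i)%:R.
Proof.
rewrite linear_sum (bigD1 i) //= linearZ /= coord_simple eqxx mulr1.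
rewrite big1 ?addr0 // => j ne.
by rewrite linearZ /= coord_simple eq_sym (negPf ne) mulr0.
Qed.

Lemma coord_inj u v : (forall i, co i u = co i v) -> u = v.
Proof. by move=> e; rewrite (coordE u) (coordE v); apply: eq_bigr => i _; rewrite e. Qed.

Lemma root_coord_sign a : (forall i, 0 <= co i (val a)) \/ (forall i, co i (val a) <= 0).
Proof.
have [c [e|e]] := @roots_simple_sum _ _ _ Phi (val a) (valP a); [left|right] => i.
  by rewrite e coord_sum.
by rewrite e linearN /= coord_sum oppr_le0.
Qed.

Lemma positiveP a : reflect (forall i, 0 <= co i (val a)) (positive a).
Proof. exact: forallP. Qed.

Lemma positive_ht a : positive a = (0 < ht (val a)).
Proof.
apply/positiveP/idP => [ge0|].
  rewrite lt_def sumr_ge0 // andbT; apply: contra (root_neq0 a).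
  rewrite psumr_eq0 // => /allP e; apply/eqP/coord_inj => i.
  by rewrite linear0; apply/eqP/e; rewrite mem_index_enum.
case: (root_coord_sign a) => // le0; rewrite ltNge sumr_le0 //.
Qed.

Lemma negative_ht a : ~~ positive a = (ht (val a) < 0).
Proof.
rewrite positive_ht -leNgt le_eqVlt.
suff /negPf -> : ht (val a) != 0 by [].
case: (root_coord_sign a) => [/positiveP | le0]; first by rewrite positive_ht => /gt_eqF ->.
have : positive (ropp a) by apply/positiveP => i; rewrite val_ropp linearN /= oppr_ge0 le0.
by rewrite positive_ht val_ropp htN oppr_gt0 => /lt_eqF ->.
Qed.

Lemma positive_opp a : positive (ropp a) = ~~ positive a.
Proof. by rewrite negative_ht positive_ht val_ropp htN oppr_gt0. Qed.

Lemma ropp_neq a : ropp a != a.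
Proof. by apply/eqP => /(congr1 (@positive _ _ _ _)); rewrite positive_opp; case: positive. Qed.

Lemma coord_pos_root a i : positive a -> 0 <= co i (val a).
Proof. by move/positiveP. Qed.

Lemma positive_coord a i : 0 < co i (val a) -> positive a.
Proof.
by case: (root_coord_sign a) => [/positiveP // | le0]; rewrite ltNge le0.
Qed.

Lemma positive_simple i : positive (simple i).
Proof. by apply/positiveP => j; rewrite coord_simple ler0n. Qed.

(** Another positive root has a further positive coordinate, which [s_i] does
    not change. *)
Lemma positive_refl_simple i a : positive a -> a != simple i ->
  positive (root_refl (simple i) a).
Proof.
move=> pa ne; have [j ji cj] : exists2 j, j != i & 0 < co j (val a).
  case: (pickP (fun j => (j != i) && (0 < co j (val a)))) => [j /andP[] | no].
    by exists j.
  have aE : val a = co i (val a) *: val (simple i).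
    apply: coord_inj => j; rewrite linearZ /= coord_simple.
    case: eqVneq => [-> | ji]; rewrite ?mulr1 // mulr0.
    have := no j; rewrite ji /= => /negbT; rewrite -leNgt => le0.
    by apply/eqP; rewrite eq_le le0 coord_pos_root.
  have := @roots_reduced _ _ _ Phi (val (simple i)) (co i (val a)) (valP _).
  rewrite -aE => /(_ (valP a)) [] e; rewrite e ?scale1r in aE.
    by rewrite (val_inj aE) eqxx in ne.
  have := coord_pos_root i pa; rewrite e; lra.
apply: (@positive_coord _ j); rewrite val_refl linearB /= linearZ /=.
by rewrite coord_simple (negPf ji) mulr0 subr0.
Qed.

Lemma reflectionE v a : reflection fm (val a) v = v - pairing v a *: val a.
Proof. by []. Qed.

Lemma form_reflection u v a : fm (reflection fm (val a) u) (reflection fm (val a) v) = fm u v.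
Proof.
rewrite !reflectionE !formBl !formBr !formZl !formZr.
rewrite !pairingE (form_sym _ (val a)); field.
by rewrite gt_eqF // form_root_gt0.
Qed.

Lemma ht_ind (P : root -> Prop) :
  (forall a, (forall b, ht (val b) < ht (val a) -> P b) -> P a) -> forall a, P a.
Proof.
move=> IH a; have [m] := ubnP #|[set b : root | ht (val b) < ht (val a)]|.
elim: m a => // m IHm a; rewrite ltnS => lem; apply: IH => b ltba; apply: IHm.
apply: leq_trans lem; apply: proper_card; apply/properP; split.
  by apply/subsetP => c; rewrite !inE => /lt_trans; apply.
by exists b; rewrite !inE ?ltxx.
Qed.

(** A positive root makes an acute angle with some simple root, as its square
    length is positive. *)
Lemma positive_acute a : positive a -> exists i,
  [/\ 0 < co i (val a), 0 < pairing (val a) (simple i) &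
      a = simple i \/ positive (root_refl (simple i) a) /\
        ht (val (root_refl (simple i) a)) < ht (val a)].
Proof.
move=> pa; have [i ci pi] : exists2 i, 0 < co i (val a) & 0 < pairing (val a) (simple i).
  case: (pickP (fun i => (0 < co i (val a)) && (0 < pairing (val a) (simple i)))).
    by move=> i /andP[]; exists i.
  move=> no; have := form_root_gt0 a; rewrite {1}(coordE (val a)) form_suml ltNge.
  case/negP; apply: sumr_le0 => i _; rewrite formZl.
  have := no i; have := coord_pos_root i pa; rewrite le_eqVlt.
  case/orP => [/eqP <- |]; first by rewrite mul0r.
  move=> ci; rewrite ci pairing_gt0 (form_sym _ (val a)) /= => /negbT.
  by rewrite -leNgt pmulr_rle0.
exists i; split=> //; case: (eqVneq a (simple i)) => [-> | ne]; [by left | right].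
split; first exact: positive_refl_simple.
rewrite val_refl htB htZ ltrBlDr ltrDl mulr_gt0 //.
by have := positive_simple i; rewrite positive_ht.
Qed.

End RootSystem.

(** * The highest root and the affine simple roots *)

Section HighestRoot.
Local Open Scope ring_scope.
Variables (R : realFieldType) (V : vectType R) (n : nat).
Variable Phi : root_system V n.
Local Notation root := (rootT Phi).
Local Notation fm := (form Phi).
Local Notation co := (coord (simple_roots Phi)).
Local Notation simple := (simple_root Phi).
Implicit Types (a b c g t : root) (u v : V) (i j : 'I_n).

Definition chi a : R := (~~ positive a)%:R.

Lemma chi_opp a : chi (ropp a) = 1 - chi a.
Proof. by rewrite /chi positive_opp; case: positive; rewrite /= ?subr0 ?subrr. Qed.

Lemma chi_pos a : positive a -> chi a = 0. Proof. by rewrite /chi => ->. Qed.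

Lemma chi_neg a : ~~ positive a -> chi a = 1. Proof. by rewrite /chi => ->. Qed.

(** [chi b] is the least [k] for which the affine root [b + k delta] is
    positive.  If [a] is a simple root or the lowest root then [a + chi a delta]
    is a simple affine root, so the reflection in it permutes the other
    positive affine roots, and maps [b + chi b delta] to the least positive one
    over the image of [b].  The coefficient of [delta] in this statement is the
    equation below. *)
Definition affine_simple a := [forall b, (b != a) && (b != ropp a) ==>
  (chi (root_refl a b) == chi b - chi a * pairing (val b) a)].

Lemma affine_simpleP a : reflect (forall b, b != a -> b != ropp a ->
  chi (root_refl a b) = chi b - chi a * pairing (val b) a) (affine_simple a).
Proof.
apply: (iffP forallP) => [h b n1 n2 | h b].
  by move: (h b); rewrite n1 n2 => /eqP.
by apply/implyP => /andP[n1 n2]; apply/eqP; exact: h.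
Qed.

(** By linearity, the equation only needs checking at positive roots. *)
Lemma affine_simple_pos a : (forall b, positive b -> b != a -> b != ropp a ->
  chi (root_refl a b) = chi b - chi a * pairing (val b) a) -> affine_simple a.
Proof.
move=> h; apply/affine_simpleP => b n1 n2.
case pb: (positive b); first exact: h.
have := h (ropp b); rewrite positive_opp pb => /(_ isT).
rewrite (can2_eq (@roppK _ _ _ _) (@roppK _ _ _ _)) (inj_eq (inv_inj (@roppK _ _ _ _))).
move=> /(_ n2 n1); rewrite refl_oppr !chi_opp val_ropp pairingN.
by move=> e; lra.
Qed.

Lemma affine_simple_simple i : affine_simple (simple i).
Proof.
apply: affine_simple_pos => b pb n1 _.
by rewrite !chi_pos ?mul0r ?subr0 ?positive_simple // positive_refl_simple.
Qed.

(** Maximal for dominance; the largest root turns out to be the only one. *)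
Definition maximal t := forall b, (forall i, co i (val t) <= co i (val b)) -> b = t.

Lemma maximal_positive t : maximal t -> positive t.
Proof.
move=> mt; apply/negPn/negP => nt.
have pt : positive (ropp t) by rewrite positive_opp.
have : ropp t = t; last by move=> e; rewrite -e pt in nt.
apply: mt => i; have := coord_pos_root i pt; rewrite val_ropp linearN /= => ge0.
by apply: le_trans (ge0); rewrite -oppr_ge0.
Qed.

Lemma maximal_dominant t b : maximal t -> positive b -> 0 <= pairing (val t) b.
Proof.
move=> mt pb; rewrite leNgt; apply/negP => lt0.
have e : root_refl b t = t.
  apply: mt => i; rewrite val_refl linearB linearZ /= lerBrDr gerDl.
  by rewrite nmulr_rle0 ?coord_pos_root.
have /(congr1 val) := e; rewrite val_refl => /eqP.
rewrite -subr_eq0 addrAC subrr add0r oppr_eq0 scaler_eq0 (negPf (root_neq0 b)) orbF.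
by move/eqP => k0; rewrite k0 ltxx in lt0.
Qed.

Lemma simple_obtuse i j : i != j -> fm (val (simple i)) (val (simple j)) <= 0.
Proof.
move=> ne; rewrite leNgt -pairing_gt0; apply/negP => gt0.
have ne' : simple i != simple j.
  apply: contra ne => /eqP /(congr1 (fun a => co i (val a))).
  rewrite !coord_simple eqxx; case: eqP => // _ /eqP; by rewrite oner_eq0.
have := coord_pos_root j (positive_refl_simple (positive_simple Phi i) ne').
rewrite val_refl linearB linearZ /= !coord_simple eqxx eq_sym (negPf ne) mulr1 sub0r.
by rewrite oppr_ge0 leNgt gt0.
Qed.

(** If the simple roots in [J] are orthogonal to all others then no root
    mixes the two kinds: reflecting a root of least height in a simple root
    with which it makes an acute angle would lead to a root of one kind. *)
Lemma root_support (J : pred 'I_n) :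
    (forall i j, J i -> ~~ J j -> fm (val (simple i)) (val (simple j)) = 0) ->
  forall b, positive b -> (forall i, J i -> co i (val b) = 0) \/
                          (forall i, ~~ J i -> co i (val b) = 0).
Proof.
move=> orth; have orthl (K : pred 'I_n) v i :
    (forall j, K j -> fm (val (simple j)) (val (simple i)) = 0) ->
    (forall j, ~~ K j -> co j v = 0) -> fm v (val (simple i)) = 0.
  move=> o z; rewrite (coordE Phi v) form_suml big1 // => j _; rewrite formZl.
  by case Kj: (K j); [rewrite o ?mulr0 | rewrite z ?mul0r // Kj].
elim/ht_ind => b IHb pb.
have [i [ci pi [bE | [prb ltb]]]] := positive_acute pb.
  rewrite bE; case Ji: (J i); [right | left] => j; rewrite coord_simple;
    case: eqP => // ->; by rewrite Ji.
have fpos : 0 < fm (val b) (val (simple i)) by rewrite -pairing_gt0.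
have nz : fm (val (root_refl (simple i) b)) (val (simple i)) != 0.
  have g0 : fm (val (simple i)) (val (simple i)) != 0.
    by rewrite gt_eqF // form_root_gt0.
  by rewrite val_refl formBl formZl pairingE divfK // lt_eqF //; lra.
have coE j : i != j -> co j (val b) = co j (val (root_refl (simple i) b)).
  move=> ij; rewrite val_refl linearB linearZ /= coord_simple eq_sym (negPf ij).
  by rewrite mulr0 subr0.
case Ji: (J i); [right | left] => j Jj.
- have ij : i != j by apply: contra Jj => /eqP <-; rewrite Ji.
  rewrite coE //; case: (IHb _ ltb prb) => [z | z]; last exact: z.
  case/eqP: nz; apply: (orthl (predC J)) => [k /= nk | k]; last by rewrite negbK => /z.
  by rewrite form_sym orth.
- have ij : i != j by apply: contraTneq Jj => <-; rewrite Ji.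
  rewrite coE //; case: (IHb _ ltb prb) => [z | z]; first exact: z.
  case/eqP: nz; apply: (orthl J) => [k Jk | k]; last exact: z.
  by rewrite orth // Ji.
Qed.

(** By dominance, a simple root outside the support of a maximal root is
    orthogonal to those inside, so irreducibility leaves nothing outside. *)
Lemma maximal_full t i : maximal t -> 0 < co i (val t).
Proof.
move=> mt; have pt := maximal_positive mt.
pose J j := 0 < co j (val t).
have nJ j : ~~ J j -> co j (val t) = 0.
  by rewrite /J -leNgt => le0; apply/eqP; rewrite eq_le le0 coord_pos_root.
have orth j k : J j -> ~~ J k -> fm (val (simple j)) (val (simple k)) = 0.
  move=> Jj nk; have := maximal_dominant mt (positive_simple Phi k).
  rewrite pairing_ge0 {1}(coordE Phi (val t)) form_suml => ge0.
  have le0 l : fm (co l (val t) *: val (simple l)) (val (simple k)) <= 0.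
    rewrite formZl; case: (eqVneq l k) => [-> | lk]; first by rewrite nJ ?mul0r.
    by rewrite mulr_ge0_le0 ?coord_pos_root ?simple_obtuse.
  have : \sum_l - fm (co l (val t) *: val (simple l)) (val (simple k)) == 0.
    by rewrite eq_le sumrN oppr_le0 ge0 oppr_ge0 sumr_le0.
  rewrite psumr_eq0 => [/allP /(_ j)|l _]; last by rewrite oppr_ge0.
  rewrite mem_index_enum oppr_eq0 formZl mulf_eq0 gt_eqF // => /(_ isT) /eqP //.
have zero_orth a b : (forall i, J i -> co i (val a) = 0) ->
    (forall i, ~~ J i -> co i (val b) = 0) -> fm (val b) (val a) = 0.
  move=> za zb; rewrite (coordE Phi (val b)) form_suml big1 // => j _; rewrite formZl.
  case Jj: (J j); last by rewrite zb ?Jj ?mul0r.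
  rewrite form_sym (coordE Phi (val a)) form_suml big1 ?mulr0 // => k _; rewrite formZl.
  case Jk: (J k); first by rewrite za ?mul0r.
  by rewrite form_sym orth ?Jk ?mulr0.
have supp b : (forall i, J i -> co i (val b) = 0) \/ (forall i, ~~ J i -> co i (val b) = 0).
  case pb: (positive b); first exact: root_support.
  have : positive (ropp b) by rewrite positive_opp pb.
  move/(root_support orth); rewrite val_ropp => -[] z; [left|right] => k /z /eqP;
    by rewrite linearN oppr_eq0 => /eqP.
pose P v := [forall j, ~~ J j ==> (co j v == 0)].
have PP v : reflect (forall j, ~~ J j -> co j v = 0) (P v).
  apply: (iffP forallP) => h j; first by move=> nj; apply/eqP/(implyP (h j)).
  by apply/implyP => /h ->.
have := @roots_irreducible _ _ _ Phi P; case.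
- move=> a b ra rb /PP Pa nPb.
  apply: (zero_orth (SeqSub rb) (SeqSub ra)) => //.
  case: (supp (SeqSub rb)) => // /PP Pb; by rewrite Pb in nPb.
- move/(_ _ (valP (simple i)))/PP/(_ i); rewrite -/(J i) coord_simple eqxx.
  by case: (J i) => // /(_ isT) /eqP; rewrite oner_eq0.
by move/(_ _ (valP t))/negP; case; apply/PP.
Qed.

Lemma maximal_acute s t : maximal s -> maximal t -> 0 < pairing (val s) t.
Proof.
move=> ms mt; rewrite pairing_gt0.
have ge0 i : 0 <= fm (val s) (val (simple i)).
  have := maximal_dominant ms (positive_simple Phi i).
  by rewrite pairing_ge0.
rewrite form_sym (coordE Phi (val t)) form_suml lt_def.
have sge0 i : 0 <= fm (co i (val t) *: val (simple i)) (val s).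
  by rewrite formZl form_sym mulr_ge0 // ltW // maximal_full.
rewrite sumr_ge0 // andbT psumr_eq0 //; apply/negP => /allP z.
have := form_root_gt0 s; rewrite {1}(coordE Phi (val s)) form_suml big1 ?ltxx // => i _.
have /implyP := z i (mem_index_enum i).
rewrite !formZl mulf_eq0 gt_eqF ?maximal_full //= => /(_ isT) /eqP ->.
by rewrite mulr0.
Qed.

(** Two maximal roots make an acute angle, so one of their two pairings is 1
    unless they are equal; but then their difference is a root, and they are
    comparable. *)
Lemma maximal_unique s t : maximal s -> maximal t -> s = t.
Proof.
move=> ms mt.
have comparable x y : maximal x -> maximal y -> pairing (val x) y = 1 -> x = y.
  move=> mx my e.
  have vE : val (root_refl y x) = val x - val y by rewrite val_refl e scale1r.
  case: (root_coord_sign (root_refl y x)) => sg.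
    apply: my => i; rewrite -subr_ge0.
    by have := sg i; rewrite vE linearB.
  apply/esym/mx => i; rewrite -subr_le0.
  by have := sg i; rewrite vE linearB.
have ge1 := pairing_ge1 (maximal_acute ms mt).
have ge1' := pairing_ge1 (maximal_acute mt ms).
have ge2 (x y : root) : 1 <= pairing (val x) y -> pairing (val x) y = 1 \/ 2 <= pairing (val x) y.
  have [m ->] := pairing_int x y; rewrite (ler_int _ 1 m).
  case: (eqVneq m 1) => [-> | m1]; first by left.
  move=> m_ge1; right; rewrite (ler_int _ 2 m); lia.
case: (ge2 _ _ ge1) => [|k2]; first exact: comparable.
case: (ge2 _ _ ge1') => [e|m2]; first by rewrite (comparable _ _ mt ms e).
apply: val_inj; apply/eqP; rewrite -subr_eq0; apply/negPn/negP => /(form_pos Phi).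
rewrite formBl !formBr (form_sym _ (val t) (val s)).
move: k2 m2; rewrite !pairingE (form_sym _ (val t) (val s)).
have := form_root_gt0 s; have := form_root_gt0 t.
move=> tt0 ss0; rewrite !ler_pdivlMr //; lra.
Qed.

Lemma exists_maximal_above b :
  exists2 t, maximal t & forall i, co i (val b) <= co i (val t).
Proof.
pose P t := [forall i, co i (val b) <= co i (val t)].
have Pb : P b by apply/forallP.
case: (@arg_maxP _ _ _ b P (fun t => ht Phi (val t)) Pb) => t /forallP Pt tmax.
exists t => // c le_tc; apply: val_inj; apply: coord_inj => i.
have Pc : P c by apply/forallP => j; exact: le_trans (Pt j) (le_tc j).
have le_ct : ht Phi (val c) <= ht Phi (val t) by exact: tmax.
have co0 j : 0 <= co j (val c - val t) by rewrite linearB subr_ge0 le_tc.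
have : ht Phi (val c - val t) == 0.
  by rewrite eq_le sumr_ge0 // andbT htB subr_le0.
rewrite psumr_eq0 // => /allP /(_ i (mem_index_enum i)) /=.
by rewrite linearB subr_eq0 => h; exact: (eqP h).
Qed.

Lemma exists_highest_root : exists2 t, maximal t &
  forall b i, co i (val b) <= co i (val t).
Proof.
have [r rin] : exists r, r \in roots Phi.
  have := roots_nonempty Phi; case: (roots Phi) => // r rs _.
  by exists r; rewrite mem_head.
have [t mt _] := exists_maximal_above (SeqSub rin).
exists t => // b i; have [t' mt' le] := exists_maximal_above b.
by rewrite (maximal_unique mt mt').
Qed.

(** Coroot pairings of other positive roots with the highest root are 0 or 1:
    if [b] had a larger one, the negative of its reflection would be a root,
    and comparing it with [t] would give [b = t]. *)
Lemma affine_simple_lowest t : maximal t ->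
  (forall b i, co i (val b) <= co i (val t)) -> affine_simple (ropp t).
Proof.
move=> mt high; have pt := maximal_positive mt.
apply: affine_simple_pos => b pb n1; rewrite roppK => n2.
rewrite refl_oppl chi_opp (chi_pos pt) subr0 mul1r (chi_pos pb) sub0r.
rewrite pairing_oppr opprK.
have ge0 : 0 <= pairing (val b) t by rewrite pairing_ge0C maximal_dominant.
have [m kE] := pairing_int b t; rewrite kE in ge0 *.
have coE i : co i (val (root_refl t b)) = co i (val b) - m%:~R * co i (val t).
  by rewrite val_refl linearB linearZ /= kE.
have [m0 | [m1 | m2]] : m = 0 \/ m = 1 \/ 2 <= m by rewrite ler0z in ge0; lia.
- have -> : root_refl t b = b by apply: val_inj; rewrite val_refl kE m0 scale0r subr0.
  by rewrite m0 chi_pos.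
- rewrite m1 chi_neg //; apply/negP => pr.
  case/eqP: n2; apply: (mt) => i.
  by have := coord_pos_root i pr; rewrite coE m1 mul1r subr_ge0.
case/eqP: n2; apply: (mt) => i; rewrite leNgt; apply/negP => lt.
have := high (ropp (root_refl t b)) i; rewrite val_ropp linearN /= coE.
have := maximal_full i mt; have : (2 : R) <= m%:~R by rewrite (ler_int _ 2 m).
nra.
Qed.

End HighestRoot.

(** * The Weyl group: inversions and length *)

Lemma bigminn_eq (P : pred nat) M k : (k < M)%N -> P k ->
  (forall l, P l -> (k <= l)%N) -> \big[minn/M]_(l < M | P l) (l : nat) = k.
Proof.
move=> kM Pk kmin; apply/eqP; rewrite eqn_leq; apply/andP; split; last first.
  elim/big_ind: _ => [|x y lex ley|i Pi]; first exact: ltnW.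
    by rewrite leq_min lex.
  exact: kmin.
have : Ordinal kM \in index_enum 'I_M by exact: mem_index_enum.
elim: (index_enum 'I_M) => // l r IHr; rewrite inE big_cons => /orP[/eqP <- | ink].
  by rewrite Pk geq_minl.
case: ifP => _; last exact: IHr.
by rewrite geq_min IHr // orbT.
Qed.

Section Weyl.
Local Open Scope ring_scope.
Variables (R : realFieldType) (V : vectType R) (n : nat).
Variable Phi : root_system V n.
Local Notation root := (rootT Phi).
Local Notation fm := (form Phi).
Local Notation co := (coord (simple_roots Phi)).
Local Notation simple := (simple_root Phi).
Local Notation W := (weyl Phi).
Local Notation refl a := (root_perm a).
Implicit Types (a b c g t : root) (u v : V) (i j : 'I_n) (x y z w : {perm root}).

Lemma root_permE a b : refl a b = root_refl a b. Proof. by rewrite permE. Qed.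

Lemma root_permK a : (refl a * refl a = 1)%g.
Proof. by apply/permP => b; rewrite permM !root_permE root_reflK perm1. Qed.

Lemma root_permKr x a : (x * refl a * refl a)%g = x.
Proof. by rewrite -mulgA root_permK mulg1. Qed.

Lemma root_permKl x a : (refl a * (refl a * x))%g = x.
Proof. by rewrite mulgA root_permK mul1g. Qed.

Lemma root_permV a : ((refl a)^-1)%g = refl a.
Proof. by apply/eqP; rewrite eq_invg_mul root_permK. Qed.

Lemma root_perm_opp a : refl (ropp a) = refl a.
Proof. by apply/permP => b; rewrite !root_permE refl_oppl. Qed.

Lemma word_prod_nil : word_prod Phi [::] = 1%g.
Proof. by rewrite /word_prod big_nil. Qed.

Lemma word_prod_cons i s : word_prod Phi (i :: s) = (refl (simple i) * word_prod Phi s)%g.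
Proof. by rewrite /word_prod big_cons. Qed.

Lemma simple_weyl i : refl (simple i) \in W.
Proof. by apply: mem_gen; apply: imset_f. Qed.

Lemma weylP x : reflect (exists s, x = word_prod Phi s) (x \in W).
Proof.
apply: (iffP idP) => [/gen_prodgP[m [c cin ->]] | [s ->]]; last first.
  by rewrite /word_prod group_prod // => i _; exact: simple_weyl.
elim: m c cin => [|m IHm] c cin; first by exists [::]; rewrite big_ord0 word_prod_nil.
have [s sE] := IHm _ (fun k => cin (lift ord0 k)).
have /imsetP[i _ cE] := cin ord0.
by exists (i :: s); rewrite big_ord_recl word_prod_cons sE cE.
Qed.

(** Permutations of the roots in the Weyl group come from isometries. *)
Lemma weyl_linear x : x \in W -> exists f : V -> V,
  [/\ forall k u v, f (k *: u + v) = k *: f u + f v,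
      forall u v, fm (f u) (f v) = fm u v & forall a, val (x a) = f (val a)].
Proof.
case/weylP => s ->; elim: s => [|i s [f [flin fisom fE]]].
  by exists id; split=> // a; rewrite word_prod_nil perm1.
exists (f \o reflection fm (val (simple i))); split=> [k u v|u v|a].
- rewrite ![(f \o _) _]/comp -flin; congr f; rewrite !reflectionE pairingD pairingZ.
  by rewrite scalerDl scalerBr scalerA opprD addrACA.
- by rewrite fisom form_reflection.
by rewrite word_prod_cons permM fE root_permE.
Qed.

Lemma weyl_pairing x a b : x \in W -> pairing (val (x a)) (x b) = pairing (val a) b.
Proof. by case/weyl_linear => f [_ fi fE]; rewrite !pairingE !fE !fi. Qed.

Lemma weyl_refl x a b : x \in W -> x (root_refl a b) = root_refl (x a) (x b).
Proof.
move=> xW; apply: val_inj; rewrite val_refl weyl_pairing //.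
have [f [fl _ fE]] := weyl_linear xW.
by rewrite !fE val_refl addrC -scaleNr fl addrC scaleNr.
Qed.

Lemma weyl_opp x a : x \in W -> x (ropp a) = ropp (x a).
Proof. by move=> xW; rewrite /ropp weyl_refl. Qed.

Lemma weyl_conj x a : x \in W -> (refl a * x = x * refl (x a))%g.
Proof. by move=> xW; apply/permP => b; rewrite !permM !root_permE weyl_refl. Qed.

Lemma weyl_sum x (k : 'I_n -> R) c (r : 'I_n -> root) : x \in W ->
  val c = \sum_i k i *: val (r i) -> val (x c) = \sum_i k i *: val (x (r i)).
Proof.
move=> xW cE; have [f [fl _ fE]] := weyl_linear xW.
have f0 : f 0 = 0 by apply: (addrI (f 0)); rewrite addr0 -[X in X + _]scale1r -fl scale1r addr0.
rewrite fE cE; transitivity (\sum_i f (k i *: val (r i))).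
  by apply: (big_morph f) => // u v; rewrite -[u]scale1r fl !scale1r.
by apply: eq_bigr => i _; rewrite -[_ *: _]addr0 fl f0 addr0 -fE.
Qed.

Lemma ht_weyl x c : x \in W ->
  ht Phi (val (x c)) = \sum_i co i (val c) * ht Phi (val (x (simple i))).
Proof.
move=> xW; rewrite (weyl_sum xW (coordE Phi (val c))).
have ht0 : ht Phi 0 = 0 by rewrite -[0](scale0r 0) htZ mul0r.
rewrite (big_morph (ht Phi) (@htD _ _ _ Phi) ht0).
by apply: eq_bigr => i _; rewrite htZ.
Qed.

Lemma root_conj a : exists2 x, x \in W & exists i, a = x (simple i).
Proof.
suff H b : positive b -> exists2 x, x \in W & exists i, b = x (simple i).
  case pa: (positive a); first exact: H.
  have [|x xW [i e]] := H (ropp a); first by rewrite positive_opp pa.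
  exists (refl (simple i) * x)%g; first by rewrite groupM ?simple_weyl.
  by exists i; rewrite permM root_permE weyl_opp // -e roppK.
elim/ht_ind: b => b IHb pb; have [i [_ _ [bE | [pr ltr]]]] := positive_acute pb.
  by exists 1%g; rewrite ?group1 //; exists i; rewrite perm1.
have [x xW [j e]] := IHb _ ltr pr.
exists (x * refl (simple i))%g; first by rewrite groupM ?simple_weyl.
by exists j; rewrite permM -e root_permE root_reflK.
Qed.

Lemma root_perm_weyl a : refl a \in W.
Proof.
have [x xW [i ->]] := root_conj a.
by rewrite -(groupMl _ xW) -weyl_conj // groupM // simple_weyl.
Qed.

Lemma refl_eq_opp a b : root_refl b a = ropp a -> a = b \/ a = ropp b.
Proof.
move/(congr1 val); rewrite val_ropp val_refl => /eqP.
rewrite -subr_eq0 opprK addrAC -mulr2n subr_eq0 => /eqP e.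
have aE : val a = (pairing (val a) b / 2) *: val b.
  by rewrite mulrC -scalerA -e -scaler_nat scalerA mulVf ?scale1r // pnatr_eq0.
have := @roots_reduced _ _ _ Phi (val b) (pairing (val a) b / 2) (valP b).
rewrite -aE => /(_ (valP a)) [] k; rewrite k in aE; [left | right]; apply: val_inj.
  by rewrite aE scale1r.
by rewrite aE val_ropp scaleN1r.
Qed.

Lemma root_perm_inj a b : positive a -> positive b -> refl a = refl b -> a = b.
Proof.
move=> pa pb /permP /(_ a); rewrite !root_permE refl_self => /esym/refl_eq_opp [] // aE.
by rewrite aE positive_opp pb in pa.
Qed.

(** The inversions of [x] in the usual left action, in which [x] acts as the
    permutation [x^-1]. *)
Definition invset x := [set a : root | positive a & ~~ positive ((x^-1)%g a)].

(** The reflection in a simple root changes the sign of this root and its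
    negative only, so just their preimages under [x^-1] matter. *)
Lemma simple_invset i x : x \in W -> positive (x (simple i)) ->
  invset (refl (simple i) * x)%g = x (simple i) |: invset x /\ x (simple i) \notin invset x.
Proof.
move=> xW px; split; last by rewrite inE permK positive_simple px.
have pi := positive_simple Phi i.
apply/setP => a; rewrite !inE invMg root_permV permM root_permE.
case: (eqVneq a (x (simple i))) => [-> | ne] /=.
  by rewrite permK refl_self positive_opp px pi.
case pa: (positive a) => //=; set b := (x^-1)%g a.
have n1 : b != simple i by apply: contra ne => /eqP <-; rewrite permKV.
case pb: (positive b); first by rewrite positive_refl_simple.
have n2 : ropp b != simple i.
  apply: contraTneq px => e; rewrite -e weyl_opp // permKV positive_opp negbK pa.
  by [].
have := @positive_refl_simple _ _ _ Phi i (ropp b).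
by rewrite refl_oppr !positive_opp pb => ->.
Qed.

Lemma invset_simple x i : x \in W ->
  #|invset (refl (simple i) * x)%g| =
    if positive (x (simple i)) then #|invset x|.+1 else #|invset x|.-1.
Proof.
move=> xW; case: ifP => px.
  by have [-> nin] := simple_invset xW px; rewrite cardsU1 nin.
have pi := positive_simple Phi i.
have x'W : (refl (simple i) * x)%g \in W by rewrite groupM ?simple_weyl.
have px' : positive ((refl (simple i) * x)%g (simple i)).
  by rewrite permM root_permE refl_self weyl_opp // positive_opp px.
by have [e nin] := simple_invset x'W px'; rewrite root_permKl in e; rewrite e cardsU1 nin.
Qed.

(** If the word is reduced, these are the inversions of the element it spells,
    in the increasing order of the corresponding reflection order: the entry
    for a letter only depends on the letters after it. *)
Fixpoint inv_seq (s : seq 'I_n) : seq root :=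
  if s is i :: s' then word_prod Phi s' (simple i) :: inv_seq s' else [::].

Lemma positive_refl_simpleE i a : a != simple i -> a != ropp (simple i) ->
  positive (root_refl (simple i) a) = positive a.
Proof.
move=> n1 n2; case pa: (positive a); first exact: positive_refl_simple.
have := @positive_refl_simple _ _ _ Phi i (ropp a).
rewrite refl_oppr !positive_opp pa (can2_eq (@roppK _ _ _ Phi) (@roppK _ _ _ Phi)).
by move=> /(_ isT n2) /negbTE.
Qed.

Lemma word_prod_weyl s : word_prod Phi s \in W.
Proof. by apply/weylP; exists s. Qed.

Lemma size_inv_seq s : size (inv_seq s) = size s.
Proof. by elim: s => //= i s ->. Qed.

Lemma word_prod_headE i s : word_prod Phi (i :: s) =
  (word_prod Phi s * refl (word_prod Phi s (simple i)))%g.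
Proof. by rewrite word_prod_cons weyl_conj // word_prod_weyl. Qed.

(** Multiplying by the reflection in a root of [inv_seq] deletes the
    corresponding letter, and several reflections in increasing order do so
    independently. *)
Lemma deletion s p : subseq p (inv_seq s) -> exists2 s',
  (word_prod Phi s * \prod_(a <- p) refl a)%g = word_prod Phi s' & (size s' + size p = size s)%N.
Proof.
elim: s p => [|i s IHs] p /=.
  by move/eqP ->; exists [::]; rewrite // big_nil mulg1.
case: p => [|a p]; first by exists (i :: s); rewrite ?big_nil ?mulg1 //= addn0.
case: eqP => [-> /IHs | _ /IHs] [s' e sz].
  exists s'; last by rewrite /= addnS sz.
  by rewrite big_cons word_prod_headE -e mulgA root_permKr.
exists (i :: s'); first by rewrite !word_prod_cons -e mulgA.
by rewrite /= addSn sz.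
Qed.

Lemma inversion_in_word s a : positive a -> ~~ positive ((word_prod Phi s)^-1%g a) ->
  a \in inv_seq s.
Proof.
elim: s => [|i s IHs] pa; first by rewrite word_prod_nil invg1 perm1 pa.
rewrite word_prod_cons invMg root_permV permM root_permE inE => np.
case: eqVneq => //= ne; apply: IHs => //; apply: contra np => pb.
apply: positive_refl_simple => //.
by apply: contra ne => /eqP <-; rewrite permKV.
Qed.

Lemma card_invset_word s : (#|invset (word_prod Phi s)| <= size s)%N.
Proof.
rewrite -size_inv_seq; apply: leq_trans (card_size _).
apply: subset_leq_card; apply/subsetP => a; rewrite inE => /andP[].
exact: inversion_in_word.
Qed.

Lemma reduced_word_exists x : x \in W ->
  exists2 s, x = word_prod Phi s & size s = #|invset x|.
Proof.
have [m] := ubnP #|invset x|; elim: m x => // m IHm x; rewrite ltnS => lem xW.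
case: (pickP (fun i => ~~ positive (x (simple i)))) => [i npi | allp].
  have x'W : (refl (simple i) * x)%g \in W by rewrite groupM ?simple_weyl.
  have cE := invset_simple i xW; rewrite (negPf npi) in cE.
  have gt0 : (0 < #|invset x|)%N.
    rewrite card_gt0; apply/set0Pn; exists (ropp (x (simple i))).
    by rewrite inE -weyl_opp // permK !positive_opp positive_simple weyl_opp // positive_opp npi.
  have [|s sE sz] := IHm (refl (simple i) * x)%g _ x'W.
    by rewrite cE; apply: leq_trans lem; rewrite prednK.
  exists (i :: s); first by rewrite word_prod_cons -sE root_permKl.
  by rewrite /= sz cE prednK.
have pos0 a : positive a -> positive (x a).
  move=> pa; rewrite positive_ht ht_weyl //.
  have hj j : 0 < ht Phi (val (x (simple j))).
    by rewrite -positive_ht; have /negbT := allp j; rewrite negbK.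
  rewrite lt_def sumr_ge0 => [|j _]; last by rewrite mulr_ge0 ?coord_pos_root ?ltW.
  rewrite andbT psumr_eq0 => [|j _]; last by rewrite mulr_ge0 ?coord_pos_root ?ltW.
  apply/negP => /allP z; case/eqP: (root_neq0 a); apply: (@coord_inj _ _ _ Phi) => j.
  have := z j (mem_index_enum j); rewrite mulf_eq0 (gt_eqF (hj j)) orbF => /eqP ->.
  by rewrite linear0.
have inv0 : invset x = set0.
  apply/setP => a; rewrite !inE; apply/negP => /andP[pa].
  by rewrite -positive_opp -weyl_opp ?groupV // => /pos0; rewrite permKV positive_opp pa.
(* an element without inversions is the identity, or else its shortest
   expression could be shortened *)
rewrite inv0 cards0; suff -> : x = 1%g by exists [::]; rewrite // word_prod_nil.
have /weylP[s0 s0E] := xW.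
have [N] := ubnP (size s0); elim: N s0 s0E => // N IHN [|i s] xE.
  by rewrite xE word_prod_nil.
rewrite /= ltnS => leN.
have xE' := xE; rewrite word_prod_headE in xE'.
set a := word_prod Phi s (simple i) in xE'.
have pa : positive (ropp a).
  have := pos0 (simple i) (positive_simple Phi i).
  by rewrite xE word_prod_cons permM root_permE refl_self weyl_opp ?word_prod_weyl.
have ina : ropp a \in inv_seq s.
  apply: inversion_in_word => //; rewrite /a -weyl_opp ?word_prod_weyl // permK.
  by rewrite positive_opp negbK positive_simple.
have [|s' s'E sz] := @deletion s [:: ropp a]; first by rewrite sub1seq.
rewrite big_seq1 root_perm_opp -xE' in s'E.
by apply: (IHN s') => //; apply: leq_trans (ltnW leN); rewrite -sz addn1.
Qed.

Lemma card_invset_max x : (#|invset x| < #|W|)%N.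
Proof.
apply: (@leq_ltn_trans #|[set a : root | positive a]|).
  by apply: subset_leq_card; apply/subsetP => a; rewrite !inE => /andP[].
rewrite -(card_in_imset (f := fun a => refl a)); last first.
  by move=> a b; rewrite !inE; exact: root_perm_inj.
rewrite [X in (_ < X)%N](cardsD1 1%g) group1 add1n ltnS; apply: subset_leq_card.
apply/subsetP => _ /imsetP[a _ ->]; rewrite !inE root_perm_weyl andbT.
apply/negP => /eqP /permP /(_ a); rewrite root_permE refl_self perm1 => /eqP.
by rewrite (negPf (ropp_neq a)).
Qed.

Lemma lenE x : x \in W -> len x = #|invset x|.
Proof.
move=> xW; rewrite /len.
apply: (bigminn_eq (P := fun k => [exists s : k.-tuple 'I_n, word_prod Phi s == x])).
- exact: card_invset_max.
- have [s -> <-] := reduced_word_exists xW.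
  by apply/existsP; exists (in_tuple s).
move=> l /existsP[s /eqP <-]; apply: leq_trans (card_invset_word _) _.
by rewrite size_tuple.
Qed.

Lemma len_word s : (len (word_prod Phi s) <= size s)%N.
Proof. by rewrite lenE ?word_prod_weyl // card_invset_word. Qed.

End Weyl.

(** * Edges of the quantum Bruhat graph *)

Section Edges.
Local Open Scope ring_scope.
Variables (R : realFieldType) (V : vectType R) (n : nat).
Variable Phi : root_system V n.
Local Notation root := (rootT Phi).
Local Notation simple := (simple_root Phi).
Local Notation W := (weyl Phi).
Local Notation refl a := (root_perm a).
Implicit Types (a b c g t : root) (u v : V) (i j : 'I_n) (x y z w : {perm root}).

(** The inversions of the reflection in [g] come in pairs [a], [partner g a]
    whose sum is a positive multiple of [g]; only [g] is its own partner. *)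
Definition partner g a := ropp (root_refl g a).

Definition flipped g a := positive a && ~~ positive (root_refl g a).

Lemma partnerK g : involutive (partner g).
Proof. by move=> a; rewrite /partner refl_oppr root_reflK roppK. Qed.

Lemma flipped_partner g a : flipped g (partner g a) = flipped g a.
Proof.
by rewrite /flipped /partner refl_oppr root_reflK !positive_opp negbK andbC.
Qed.

Lemma partner_self g : partner g g = g.
Proof. by rewrite /partner refl_self roppK. Qed.

Lemma flipped_self g : positive g -> flipped g g.
Proof. by move=> pg; rewrite /flipped pg refl_self positive_opp pg. Qed.

Lemma val_partner g a : val (partner g a) = pairing (val a) g *: val g - val a.
Proof. by rewrite val_ropp val_refl opprB. Qed.

Lemma flipped_pairing g a : positive g -> flipped g a -> 1 <= pairing (val a) g.
Proof.
rewrite /flipped !positive_ht val_refl htB htZ => pg /andP[pa].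
rewrite -leNgt subr_le0 => le; apply: pairing_ge1.
by rewrite -(pmulr_lgt0 _ pg); exact: lt_le_trans pa le.
Qed.

Lemma ht_weyl_partner x g a : x \in W ->
  ht Phi (val (x (partner g a))) =
    pairing (val a) g * ht Phi (val (x g)) - ht Phi (val (x a)).
Proof.
by move=> xW; rewrite weyl_opp // weyl_refl // val_ropp val_refl weyl_pairing // htN htB htZ opprB.
Qed.

Lemma sum_positive_refl g (F : root -> R) :
  \sum_(a : root | positive a) F (root_refl g a) =
  \sum_(a : root | positive a) F a
    + \sum_(a : root | flipped g a) (F (ropp a) - F a).
Proof.
rewrite sumrB addrCA -[X in _ = X + _]addr0.
rewrite (bigID (fun a => positive (root_refl g a))) /= addrC.
rewrite [X in _ = _ + (X - _)](bigID (fun a => positive (root_refl g a))) /=.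
rewrite addrK addr0; congr (_ + _).
  rewrite [RHS](reindex_inj (inv_inj (partnerK g))) /=.
  apply: eq_big => a; first by rewrite -/(flipped g _) flipped_partner.
  by rewrite /partner roppK.
rewrite [RHS](reindex_inj (inv_inj (root_reflK g))) /=.
by apply: eq_bigl => a; rewrite root_reflK andbC.
Qed.

Lemma card_invsetE x : #|invset x|%:R = \sum_(a : root | positive a) chi (x^-1 a)%g.
Proof.
rewrite -sum1_card natr_sum (eq_bigl (fun a => positive a && ~~ positive (x^-1 a)%g)).
  by rewrite big_mkcondr; apply: eq_bigr => a _; rewrite /chi; case: positive.
by move=> a; rewrite inE.
Qed.

(** Roots with positive image under the reflection in [g] are permuted by it,
    and contribute equally to both lengths. *)
Lemma len_refl x g : x \in W ->
  (len (x * refl g)%g)%:R = (len x)%:R +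
    \sum_(a : root | flipped g a) (1 - chi (x^-1 a)%g - chi (x^-1 (partner g a))%g) :> R.
Proof.
move=> xW; have xgW : (x * refl g)%g \in W by rewrite groupM // root_perm_weyl.
rewrite !lenE // !card_invsetE.
rewrite (eq_bigr (fun a => chi (x^-1 (root_refl g a))%g)); last first.
  by move=> a _; rewrite invMg root_permV permM root_permE.
rewrite (sum_positive_refl g (fun a => chi (x^-1 a)%g)); congr (_ + _).
have e : \sum_(a | flipped g a) chi (x^-1 (partner g a))%g =
    \sum_(a | flipped g a) chi (x^-1 a)%g.
  rewrite [RHS](reindex_inj (inv_inj (partnerK g))) /=.
  by apply: eq_bigl => a; rewrite flipped_partner.
rewrite [RHS]sumrB e -sumrB; apply: eq_bigr => a _.
by rewrite weyl_opp ?groupV // chi_opp.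
Qed.

Lemma two_rho g : 2 * pairing (rho Phi) g = \sum_(a : root | flipped g a) pairing (val a) g.
Proof.
pose F a := pairing (val a) g.
have := sum_positive_refl g F; rewrite (eq_bigr (fun a => - F a)); last first.
  move=> a _; rewrite /F val_refl pairingB pairingZ pairing_self; ring.
rewrite [X in _ + X](eq_bigr (fun a => - 2 * F a)); last first.
  by move=> a _; rewrite /F val_ropp pairingN; ring.
rewrite sumrN -mulr_sumr; set S := \sum_(a | positive a) _.
have -> : 2 * pairing (rho Phi) g = S.
  rewrite /rho pairingZ mulrA divff ?pnatr_eq0 // mul1r.
  have p0 : pairing (0 : V) g = 0 by rewrite -[0](scale0r 0) pairingZ mul0r.
  exact: (big_morph (fun v => pairing v g) (fun u v => pairingD u v g) p0).
rewrite -[\sum_(_ | flipped g _) pairing _ _]/(\sum_(a : root | flipped g a) F a).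
lra.
Qed.

Lemma chi_ht a : chi a = if 0 < ht Phi (val a) then 0 else 1.
Proof. by rewrite /chi positive_ht; case: ifP. Qed.

Lemma chi_le1 a : chi a <= 1.
Proof. by rewrite chi_ht; case: ifP; rewrite ?ler01. Qed.

(** By the two preceding sums, the definition of an edge prescribes a sum over
    the pairs [a], [partner g a].  As their images under [x^-1] add up to a
    multiple of the image of [g], each term of the sum is bounded by its value
    at an edge; so the sum attains the prescribed value only if each term does.
    For the edges up in the Bruhat order, where [x^-1 g] is positive, this means
    that one root of each pair becomes negative; for the others, that both do
    and that the pairing with [g] is 1. *)
Lemma qbg_edgeP x g : x \in W -> positive g ->
  reflect (forall a, flipped g a -> a != g ->
      chi (x^-1 a)%g + chi (x^-1 (partner g a))%g =
        1 + pairing (val a) g * chi (x^-1 g)%g)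
    (qbg_edge x g (x * refl g)%g).
Proof.
move=> xW pg; have xVW : (x^-1)%g \in W by rewrite groupV.
rewrite /qbg_edge pg eqxx /= -(eqr_nat R) len_refl // -addn1 natrD two_rho.
rewrite !(bigD1 g (flipped_self pg)) /= partner_self pairing_self.
set D := \sum_(a | _ && _) _; set K := \sum_(a | _ && _) _.
have kge1 a : flipped g a && (a != g) -> 1 <= pairing (val a) g.
  by case/andP=> fa _; exact: flipped_pairing.
have K0 : 0 <= K by apply: sumr_ge0 => a /kge1; exact: le_trans ler01.
case px: (positive (x^-1 g)%g).
  rewrite (chi_pos px); have t0 a : flipped g a && (a != g) ->
      0 <= 1 - chi (x^-1 a)%g - chi (x^-1 (partner g a))%g.
    move/kge1 => k1; rewrite !chi_ht ht_weyl_partner //.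
    move: px; rewrite positive_ht => px.
    case: ltP => h1; first by case: ifP; lra.
    by rewrite ifT; [lra | nra].
  have D0 : 0 <= D by exact: sumr_ge0.
  have -> : ((len x)%:R + (1 - 0 - 0 + D) == (len x)%:R + 1 - (2 + K)) = false.
    by apply/eqP; lra.
  have -> : ((len x)%:R + (1 - 0 - 0 + D) == (len x)%:R + 1%:R) = (D == 0).
    by apply/eqP/eqP => e; lra.
  rewrite orbF /D psumr_eq0 //; apply: (iffP allP) => h a.
    move=> fa ne; have := h a (mem_index_enum a); rewrite fa ne /= => /eqP; lra.
  move=> _; apply/implyP => /andP[fa ne]; have := h a fa ne; rewrite mulr0 => e.
  by apply/eqP; lra.
have nx : ~~ positive (x^-1 g)%g by rewrite px.
rewrite (chi_neg nx); have t0 a : flipped g a && (a != g) ->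
    1 - chi (x^-1 a)%g - chi (x^-1 (partner g a))%g <= 0.
  move/kge1 => k1; rewrite !chi_ht ht_weyl_partner //.
  move: nx; rewrite negative_ht => nx.
  case: ltP => h1; last by case: ifP; lra.
  by rewrite ifF; [lra | apply/negbTE; rewrite -leNgt; nra].
have D0 : D <= 0 by exact: sumr_le0.
have -> : ((len x)%:R + (1 - 1 - 1 + D) == (len x)%:R + 1%:R) = false.
  by apply/eqP; lra.
have -> : ((len x)%:R + (1 - 1 - 1 + D) == (len x)%:R + 1 - (2 + K)) = (D + K == 0).
  by apply/eqP/eqP => e; lra.
rewrite /= /D /K -big_split psumr_eq0 /=; last first.
  move=> a /kge1; have := chi_le1 (x^-1 a)%g; have := chi_le1 (x^-1 (partner g a))%g; lra.
apply: (iffP allP) => h a.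
  move=> fa ne; have := h a (mem_index_enum a); rewrite fa ne /= => /eqP; lra.
move=> _; apply/implyP => /andP[fa ne]; have := h a fa ne; rewrite mulr1 => e.
by apply/eqP; lra.
Qed.

End Edges.

(** * The walls of affine simple roots *)

Section AffineWalls.
Local Open Scope ring_scope.
Variables (R : realFieldType) (V : vectType R) (n : nat).
Variable Phi : root_system V n.
Local Notation root := (rootT Phi).
Local Notation simple := (simple_root Phi).
Local Notation W := (weyl Phi).
Local Notation refl a := (root_perm a).
Implicit Types (a b c g t : root) (u v : V) (i j : 'I_n) (x y z w : {perm root}).

Definition edge x g := (x \in W) && qbg_edge x g (x * refl g)%g.

Lemma edgeP x g : x \in W -> positive g ->
  reflect (forall a, flipped g a -> a != g ->
      chi (x^-1 a)%g + chi (x^-1 (partner g a))%g =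
        1 + pairing (val a) g * chi (x^-1 g)%g) (edge x g).
Proof. by move=> xW pg; rewrite /edge xW; exact: qbg_edgeP. Qed.

Lemma edge_pos x g : edge x g -> (x \in W) && positive g.
Proof. by case/andP=> -> /and3P[]. Qed.

Lemma edge_up x g : edge x g -> positive (x^-1 g)%g -> len (x * refl g)%g = (len x).+1.
Proof.
move=> e px; have /andP[xW pg] := edge_pos e.
apply/eqP; rewrite -(eqr_nat R) len_refl // (bigD1 g (flipped_self pg)) /=.
rewrite partner_self chi_pos // big1 ?addr0 ?subr0 -1?natr1 // => a /andP[fa ne].
by have := edgeP xW pg e _ fa ne; rewrite (chi_pos px) mulr0; lra.
Qed.

Lemma weyl_partner x g a : x \in W -> x (partner g a) = partner (x g) (x a).
Proof. by move=> xW; rewrite weyl_opp // weyl_refl. Qed.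

(** A pair of inversions of the reflection in [x a] is mapped by [x^-1] to a
    pair [b], [partner a b]; for such pairs, the edge equation is the equation
    that makes [a] affine simple. *)
Lemma affine_cross_edge a x : affine_simple a -> x \in W -> positive (x a) ->
  edge x (x a).
Proof.
move=> /affine_simpleP aff xW px; apply/edgeP => // b fb ne.
have xVW : (x^-1)%g \in W by rewrite groupV.
rewrite weyl_partner // permK chi_opp aff.
- by rewrite -(weyl_pairing _ _ xW) permKV; ring.
- by apply: contra ne => /eqP <-; rewrite permKV.
case/andP: fb => pb _; apply: contraTneq pb => e.
by rewrite -[b](permKV x) e weyl_opp // positive_opp px.
Qed.

(** Otherwise [x a] would be an inversion of the reflection in [g].  Let [c]
    be [x^-1 g]; the edge equation for this inversion and
    the affine equations for [c] and for the partner of [a] then force values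
    of [chi] that are incompatible with the heights of these roots. *)
Lemma affine_stays_pos a x g : affine_simple a -> edge x g -> positive (x a) ->
  g != x a -> positive (root_refl g (x a)).
Proof.
move=> /affine_simpleP aff exg px ne.
have /andP[xW pg] := edge_pos exg; have xVW : (x^-1)%g \in W by rewrite groupV.
apply/negPn/negP => nr; have fl : flipped g (x a) by rewrite /flipped px.
have := edgeP xW pg exg _ fl; rewrite eq_sym => /(_ ne).
rewrite weyl_partner // permK -(weyl_pairing _ _ xVW) permK.
have k1 := flipped_pairing pg fl; rewrite -(weyl_pairing _ _ xVW) permK in k1.
set c := (x^-1 g)%g in k1 *; have xc : x c = g by rewrite permKV.
have m1 : 1 <= pairing (val c) a.
  by apply: pairing_ge1; rewrite pairing_gt0C; exact: lt_le_trans ltr01 k1.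
have ca : c != a by apply: contra ne => /eqP <-; rewrite xc.
have cna : c != ropp a.
  by apply: contraTneq pg => e; rewrite -xc e weyl_opp // positive_opp px.
have pa : partner c a != a.
  apply/eqP => /(congr1 (@ropp _ _ _ _)); rewrite /partner roppK => /refl_eq_opp [] e.
    by rewrite -e eqxx in ca.
  by rewrite e roppK eqxx in cna.
have pna : partner c a != ropp a.
  apply/eqP => /(congr1 val)/eqP; rewrite val_partner val_ropp -subr_eq0 opprK subrK.
  rewrite scaler_eq0 (negPf (root_neq0 c)) orbF => /eqP k0.
  by move: k1; rewrite k0 ler10.
have e1 := aff _ ca cna; have e2 := aff _ pa pna.
have htE : ht Phi (val (root_refl a (partner c a))) =
    pairing (val a) c * ht Phi (val (root_refl a c)) + ht Phi (val a).
  rewrite 2!val_refl val_partner pairingB pairingZ pairing_self !htB !htZ; ring.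
rewrite val_partner pairingB pairingZ pairing_self in e2.
move: e1 e2; rewrite (chi_ht (root_refl a _)) (chi_ht (root_refl a (partner _ _))) htE.
rewrite (chi_ht a) (chi_ht c) (chi_ht (partner c a)).
set k := pairing (val a) c in k1 *; set m := pairing (val c) a in m1 *.
(* [chi] has the values 0 and 1 only, while [k] and [m] are at least 1 *)
case: (ltP 0 (ht Phi (val a))) => ha.
  case: (ltP 0 (ht Phi (val (root_refl a c)))) => h1; case: (ltP 0 (ht Phi (val c))) => h2;
  case: (ltP 0 (ht Phi (val (partner c a)))) => h3; case: ltP => h4; nra.
case: (ltP 0 (ht Phi (val (root_refl a c)))) => h1; case: (ltP 0 (ht Phi (val c))) => h2;
case: (ltP 0 (ht Phi (val (partner c a)))) => h3; case: ltP => h4; nra.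
Qed.

(** Away from [a], the affine reflection in [a] changes [chi] by a linear
    form, and the equation that characterizes edges is linear. *)
Lemma affine_mirror_edge a x g : affine_simple a -> edge x g ->
  g != x a -> g != ropp (x a) -> positive (root_refl g (x a)) = positive (x a) ->
  edge (refl a * x)%g g.
Proof.
move=> /affine_simpleP aff exg n1 n2 same.
have /andP[xW pg] := edge_pos exg; have xVW : (x^-1)%g \in W by rewrite groupV.
have sxW : (refl a * x)%g \in W by rewrite groupM ?root_perm_weyl.
have far b : b != x a -> b != ropp (x a) ->
    chi ((refl a * x)^-1 b)%g = chi (x^-1 b)%g - chi a * pairing (val (x^-1 b)%g) a.
  move=> m1 m2; rewrite invMg root_permV permM root_permE aff //.
    by apply: contra m1 => /eqP <-; rewrite permKV.
  by apply: contra m2 => /eqP e; rewrite -weyl_opp // -e permKV.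
have flfar b : flipped g b -> (b != x a) && (b != ropp (x a)).
  move=> /andP[pb nb]; apply/andP; split; apply/eqP => e; move: pb nb; rewrite e.
    by rewrite same => ->.
  by rewrite refl_oppr !positive_opp same => ->.
apply/edgeP => // b fb ne; have /andP[f1 f2] := flfar _ fb.
have /andP[f3 f4] : (partner g b != x a) && (partner g b != ropp (x a)).
  by apply: flfar; rewrite flipped_partner.
rewrite !far //.
rewrite weyl_partner // val_partner pairingB pairingZ.
have := edgeP xW pg exg _ fb ne; rewrite weyl_partner // weyl_pairing //.
set p := pairing (val b) g; set q := pairing _ a; set r := pairing _ a => e.
have -> : chi ((x^-1)%g b) - chi a * q +
    (chi (partner (x^-1 g)%g (x^-1 b)%g) - chi a * (p * r - q)) =
    chi ((x^-1)%g b) + chi (partner (x^-1 g)%g (x^-1 b)%g) - chi a * p * r by ring.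
by rewrite e; ring.
Qed.

(** ** The reflection order of a reduced word *)

Lemma inv_seq_invset s : all (@positive _ _ _ Phi) (inv_seq Phi s) ->
  inv_seq Phi s =i invset (word_prod Phi s).
Proof.
elim: s => [|i s IHs] /=.
  by move=> _ a; rewrite !inE word_prod_nil invg1 perm1 in_nil; case: positive.
case/andP=> pa al a; rewrite word_prod_cons.
have [-> _] := simple_invset (word_prod_weyl Phi s) pa.
by rewrite in_cons in_setU1 IHs.
Qed.

Lemma inv_seq_cut s g : g \in inv_seq Phi s -> exists l i s',
  inv_seq Phi s = l ++ g :: inv_seq Phi s' /\ word_prod Phi s' (simple i) = g.
Proof.
elim: s => // i s IHs; rewrite /= inE => /orP[/eqP -> | /IHs [l [j [s' [-> e]]]]].
  by exists [::], i, s.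
by exists (word_prod Phi s (simple i) :: l), j, s'.
Qed.

Definition pos_root a := if positive a then a else ropp a.

Lemma pos_root_positive a : positive (pos_root a).
Proof. by rewrite /pos_root; case: ifP => // pa; rewrite positive_opp pa. Qed.

Lemma pos_root_opp a : pos_root (ropp a) = pos_root a.
Proof. by rewrite /pos_root positive_opp; case: (positive a); rewrite /= ?roppK. Qed.

Lemma pos_root_eq g a : positive g -> (g == pos_root a) = (g == a) || (g == ropp a).
Proof.
move=> pg; rewrite /pos_root; case: ifP => pa.
  case: eqP => //= _; apply/esym/negbTE; apply: contraTneq pg => ->.
  by rewrite positive_opp pa.
case: (eqVneq g (ropp a)) => [-> | _]; first by rewrite orbT.
by rewrite orbF; apply/esym/negbTE; apply: contraTneq pg => ->; rewrite pa.
Qed.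

Section Order.
Variable s : seq 'I_n.
Hypothesis s_uniq : uniq (inv_seq Phi s).
Hypothesis s_all : forall a, (a \in inv_seq Phi s) = positive a.

Definition before g h := (index g (inv_seq Phi s) < index h (inv_seq Phi s))%N.

(** The roots after [g] are the inversions of a suffix [x] of the word, and
    [x] carries a simple root to [g]. *)
Lemma order_cut g : positive g -> exists x i,
  [/\ x \in W, x (simple i) = g &
      forall h, positive h -> h != g -> before g h = ~~ positive (x^-1 h)%g].
Proof.
rewrite -s_all => /inv_seq_cut [l [i [s' [sE e]]]].
exists (word_prod Phi s'), i; split=> //; first exact: word_prod_weyl.
have al : all (@positive _ _ _ Phi) (inv_seq Phi s').
  by apply/allP => a ain; rewrite -s_all sE mem_cat inE ain !orbT.
move=> h ph ne; have := inv_seq_invset al h; rewrite inE ph /= => <-.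
have := s_uniq; rewrite /before sE cat_uniq => /and3P[_ /hasPn nin /= /andP[gn _]].
have := s_all h; rewrite ph sE mem_cat in_cons (negPf ne) /= !index_cat /= eqxx.
have -> : (g \in l) = false by apply/negbTE/nin; rewrite mem_head.
rewrite eq_sym (negPf ne) addn0; case hl: (h \in l) => /=; last first.
  by move=> ->; rewrite addnS ltnS leq_addr.
have -> : (h \in inv_seq Phi s') = false.
  by apply/negP => hin; have := nin h; rewrite inE hin orbT hl => /(_ isT).
by rewrite ltnNge ltnW // index_mem.
Qed.

Lemma before_total g h : positive g -> positive h -> g != h -> before g h || before h g.
Proof.
rewrite -!s_all /before => gin hin; rewrite -neq_ltn; apply: contra => /eqP e.
by rewrite -(nth_index g gin) e nth_index.
Qed.

Lemma before_irr : irreflexive before. Proof. by move=> g; exact: ltnn. Qed.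

Lemma before_trans : transitive before. Proof. by move=> h g k; exact: ltn_trans. Qed.

(** Convexity of the order.  With [x] as in [order_cut], the positive one of
    [a] and its negative precedes [g] if and only if [x^-1] keeps the sign of
    [a].  Reflecting [a] in [g] means reflecting [x^-1 a] in a simple root,
    which does not change the sign of [x^-1 a]; so only the sign of [a] itself
    counts. *)
Lemma before_refl g a : positive g -> g != pos_root a ->
  before (pos_root (root_refl g a)) g =
    before (pos_root a) g (+) (positive a != positive (root_refl g a)).
Proof.
move=> pg ne; have [x [i [xW xe cut]]] := order_cut pg.
have xVW : (x^-1)%g \in W by rewrite groupV.
have key c : g != pos_root c -> before (pos_root c) g = (positive c == positive (x^-1 c)%g).
  move=> nc; have pc := pos_root_positive c.
  have -> : before (pos_root c) g = ~~ before g (pos_root c).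
    have := before_total pg pc nc; case b1: (before g _); case b2: (before _ g) => //.
    by have := before_trans b1 b2; rewrite before_irr.
  rewrite cut // 1?eq_sym // negbK /pos_root; case: ifP => pc'; rewrite ?pc' //.
  by rewrite weyl_opp // positive_opp; case: positive.
have ne' : g != pos_root (root_refl g a).
  apply: contra ne; rewrite !pos_root_eq // => /orP[/eqP e | /eqP e].
    have -> : a = ropp g by rewrite -(root_reflK g a) -e refl_self.
    by rewrite roppK eqxx orbT.
  have -> : a = g by rewrite -(root_reflK g a) -[root_refl g a]roppK -e refl_oppr refl_self roppK.
  by rewrite eqxx.
rewrite !key // weyl_refl // -xe permK positive_refl_simpleE.
- by case: (positive a); case: (positive (root_refl _ _)); case: (positive (x^-1 a)%g).
- apply: contra ne => /eqP e; have -> : a = g by rewrite -xe -e permKV.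
  by rewrite /pos_root pg.
apply: contra ne => /eqP e; have -> : a = ropp g by rewrite -xe -weyl_opp // -e permKV.
by rewrite pos_root_opp /pos_root pg.
Qed.

Lemma affine_wall a : affine_simple a ->
  wall (fun x g => x * refl g)%g (mem W) edge (@positive _ _ _ Phi) before
    (fun x : {perm root} => positive (x a)) (fun x => refl a * x)%g
    (fun x : {perm root} => pos_root (x a)).
Proof.
move=> aff; have aW := root_perm_weyl a; split.
- exact: before_irr.
- exact: before_trans.
- exact: before_total.
- exact: root_permKr.
- exact: edge_pos.
- by move=> x; exact: pos_root_positive.
- by move=> x; rewrite /= groupMl.
- by move=> x g; rewrite /= groupMr // root_perm_weyl.
- by move=> x; rewrite root_permKl.
- by move=> x xW; rewrite permM root_permE refl_self weyl_opp // positive_opp.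
- by move=> x xW; rewrite permM root_permE refl_self weyl_opp // pos_root_opp.
- by move=> x g; rewrite mulgA.
- move=> x xW; rewrite weyl_conj //; congr (_ * _)%g.
  by rewrite /pos_root; case: ifP => // _; rewrite root_perm_opp.
- by move=> x xW px; rewrite /pos_root px; exact: affine_cross_edge.
- move=> x g px e; rewrite /pos_root px => ne.
  have pr := affine_stays_pos aff e px ne; rewrite permM root_permE pr /=.
  apply: affine_mirror_edge => //; last by rewrite pr px.
  have /andP[_ pg] := edge_pos e.
  by apply: contraTneq pg => ->; rewrite positive_opp px.
- move=> x g npx e; rewrite permM root_permE => npr.
  have /andP[_ pg] := edge_pos e.
  have n1 : g != x a by apply: contraTneq pg => ->.
  apply: affine_mirror_edge => //; last by rewrite (negPf npr) (negPf npx).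
  apply: contra npr => /eqP ->; rewrite refl_oppl refl_self positive_opp.
  exact: npx.
move=> x g xW pg ne; rewrite permM root_permE; exact: before_refl.
Qed.

End Order.
End AffineWalls.

(** * Unique increasing walks *)

Section UniqueWalks.
Local Open Scope ring_scope.
Variables (R : realFieldType) (V : vectType R) (n : nat).
Variable Phi : root_system V n.
Local Notation root := (rootT Phi).
Local Notation co := (coord (simple_roots Phi)).
Local Notation simple := (simple_root Phi).
Local Notation W := (weyl Phi).
Local Notation refl a := (root_perm a).
Local Notation qwalk := (walk (fun (x : {perm root}) g => x * refl g)%g (@edge _ _ _ Phi)).
Implicit Types (a b c g t : root) (i j : 'I_n) (x y z w : {perm root}).

(** Moving to the mirror image in a wall that has [y] on its negative side. *)
Definition descend y z :=
  [exists a, [&& affine_simple a, ~~ positive (y a) & z == (refl a * y)%g]].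

(** Consider the sum over a closed set [U] of the heights of [z a], [a] affine
    simple.  Pairs of vertices of [U] joined by [a] cancel, and an edge joining
    [U] to its complement contributes a positive number, as it enters [U].
    But the affine simple roots satisfy a relation with positive coefficients,
    so no edge of this kind exists. *)
Lemma descend_connect y z : y \in W -> z \in W -> connect descend y z.
Proof.
move=> yW zW; pose U := [set x in W | connect descend y x].
have UW x : x \in U -> x \in W by rewrite inE => /andP[].
have yU : y \in U by rewrite inE yW connect0.
have closed x a : x \in U -> affine_simple a -> ~~ positive (x a) -> (refl a * x)%g \in U.
  rewrite !inE => /andP[xW c] aff np; rewrite groupM ?root_perm_weyl //=.
  apply: connect_trans c _; apply: connect1; apply/existsP; exists a.
  by rewrite aff np eqxx.
pose A a := \sum_(x in U) ht Phi (val (x a)).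
have A_out a : A a = \sum_(x in U | (refl a * x)%g \notin U) ht Phi (val (x a)).
  rewrite /A (bigID (fun x => (refl a * x)%g \in U)) /=.
  set S := (X in X + _ = _); suff -> : S = 0 by rewrite add0r.
  suff : S = - S by lra.
  rewrite {1}/S (reindex_inj (mulgI (refl a))) /= -sumrN.
  apply: eq_big => x; first by rewrite root_permKl andbC.
  case/andP=> xU _.
  have xW : x \in W by have := UW _ xU; rewrite groupMl // root_perm_weyl.
  by rewrite permM root_permE refl_self weyl_opp // val_ropp htN.
have out_pos a x : affine_simple a -> (x \in U) && ((refl a * x)%g \notin U) ->
    0 < ht Phi (val (x a)).
  move=> aff /andP[xU nxU]; rewrite -positive_ht; apply: contraR nxU => np.
  exact: closed.
have A_ge0 a : affine_simple a -> 0 <= A a.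
  by move=> aff; rewrite A_out sumr_ge0 // => x /(out_pos _ _ aff)/ltW.
have [t mt high] := exists_highest_root Phi.
have At : A (ropp t) = - \sum_i co i (val t) * A (simple i).
  rewrite /A (eq_bigr (fun x => - \sum_i co i (val t) * ht Phi (val (x (simple i))))).
    rewrite sumrN exchange_big; congr (- _).
    by apply: eq_bigr => i _; rewrite mulr_sumr.
  move=> x /UW xW; rewrite weyl_opp // val_ropp htN; congr (- _).
  exact: ht_weyl.
have A0 i : A (simple i) = 0.
  have mA j : 0 <= co j (val t) * A (simple j).
    by rewrite mulr_ge0 ?A_ge0 ?affine_simple_simple // ltW // maximal_full.
  have := A_ge0 _ (affine_simple_lowest mt high); rewrite At oppr_ge0 => le0.
  have : \sum_i co i (val t) * A (simple i) == 0 by rewrite eq_le le0 sumr_ge0.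
  rewrite psumr_eq0 // => /allP /(_ i (mem_index_enum i)).
  by rewrite /= mulf_eq0 gt_eqF ?maximal_full // => /eqP.
have simple_closed i x : x \in U -> (refl (simple i) * x)%g \in U.
  move=> xU; apply/negPn/negP => nxU; have aff := affine_simple_simple Phi i.
  have := A0 i; rewrite A_out => /eqP; rewrite psumr_eq0 => [/allP|w /(out_pos _ _ aff)/ltW //].
  move/(_ x (mem_index_enum x)); rewrite xU nxU /= gt_eqF //.
  by apply: out_pos; rewrite // xU.
have [s sE] : exists s, (z * y^-1)%g = word_prod Phi s.
  by apply/weylP; rewrite groupM ?groupV.
have -> : z = (word_prod Phi s * y)%g by rewrite -sE mulgKV.
suff : (word_prod Phi s * y)%g \in U by rewrite inE => /andP[].
elim: s {sE} => [|i s IHs]; first by rewrite word_prod_nil mul1g.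
by rewrite word_prod_cons -mulgA simple_closed.
Qed.

Lemma simple_edge x i : x \in W -> edge x (simple i).
Proof.
move=> xW; apply/edgeP => //; first exact: positive_simple.
move=> a /andP[pa np] ne; case/negP: np; exact: positive_refl_simple.
Qed.

Lemma qwalk_exists x y : x \in W -> y \in W -> exists p, qwalk x p y.
Proof.
move=> xW yW; have [s sE] : exists s, (x^-1 * y)%g = word_prod Phi s.
  by apply/weylP; rewrite groupM ?groupV.
have -> : y = (x * word_prod Phi s)%g by rewrite -sE mulKVg.
exists [seq simple i | i <- s]; elim: s {sE} x xW => [|i s IHs] x xW /=.
  by rewrite word_prod_nil mulg1.
rewrite simple_edge //= word_prod_cons mulgA; apply: IHs.
by rewrite groupM ?root_perm_weyl.
Qed.

Lemma qbg_pathE x p y : x \in W -> qbg_path x p y = qwalk x p y.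
Proof.
elim: p x => //= g p IHp x xW; rewrite /edge xW IHp //.
by rewrite groupM ?root_perm_weyl.
Qed.

Lemma qwalk_weyl x p y : x \in W -> qwalk x p y -> y \in W.
Proof.
elim: p x => [|g p IHp] x xW /=; first by move/eqP <-.
by case/andP=> _; apply: IHp; rewrite groupM ?root_perm_weyl.
Qed.

Lemma qwalk_positive x p y : qwalk x p y -> all (@positive _ _ _ Phi) p.
Proof.
elim: p x => //= g p IHp x /andP[/edge_pos/andP[_ ->]]; exact: IHp.
Qed.

Lemma qwalk_prod x p y : qwalk x p y -> y = (x * \prod_(g <- p) refl g)%g.
Proof.
elim: p x => [|g p IHp] x /=; first by move/eqP ->; rewrite big_nil mulg1.
by case/andP=> _ /IHp ->; rewrite big_cons mulgA.
Qed.

Section Reduced.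
Variable s : seq 'I_n.
Hypothesis s_uniq : uniq (inv_seq Phi s).
Hypothesis s_all : forall a, (a \in inv_seq Phi s) = positive a.
Local Notation before := (@before R V n Phi s).
Let s_wall a : affine_simple a -> _ := affine_wall s_uniq s_all (a := a).

Lemma sorted_inv_seq : sorted before (inv_seq Phi s).
Proof.
case E: (inv_seq Phi s) s_uniq => [//|r l] rlu; rewrite -E in rlu *.
by apply/(sortedP r) => k ltk; rewrite /before !index_uniq // ltnW.
Qed.

Lemma sorted_filter_inv_seq p : all (@positive _ _ _ Phi) p -> sorted before p ->
  p = [seq g <- inv_seq Phi s | g \in p].
Proof.
move=> pp sp.
apply: (irr_sorted_eq (@before_trans _ _ _ Phi s) (@before_irr _ _ _ Phi s)) => //.
  exact: (sorted_filter (@before_trans _ _ _ Phi s)) sorted_inv_seq.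
move=> g; rewrite mem_filter s_all; case: (boolP (g \in p)) => //= gp.
by rewrite (allP pp).
Qed.

Lemma sorted_subseq p : all (@positive _ _ _ Phi) p -> sorted before p ->
  subseq p (inv_seq Phi s).
Proof. by move=> pp sp; rewrite (sorted_filter_inv_seq pp sp) filter_subseq. Qed.

Hypothesis s_reduced : (size s <= len (word_prod Phi s))%N.

(** Deleting letters from a reduced word changes its product. *)
Lemma increasing_prod_neq1 p : all (@positive _ _ _ Phi) p -> sorted before p ->
  (\prod_(g <- p) refl g)%g = 1%g -> p = [::].
Proof.
move=> pp sp p1; have [s' e sz] := deletion (sorted_subseq pp sp).
rewrite p1 mulg1 in e; apply/nilP; rewrite /nilp -leqn0.
have le : (size s <= size s')%N by rewrite (leq_trans s_reduced) // e len_word.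
by rewrite -(leq_add2l (size s')) sz addn0.
Qed.

(** Some negative root becomes positive under [h]; like every root, it is in
    the orbit of a simple root. *)
Lemma separating_root h : h \in W -> h != 1%g -> exists y a,
  [/\ y \in W, affine_simple a, ~~ positive (y a) & positive (h (y a))].
Proof.
move=> hW h1; have [s0 hE sz] := reduced_word_exists hW.
have [b] : exists b, b \in invset h.
  apply/set0Pn; rewrite -card_gt0 lt0n; apply: contra h1; rewrite -sz => /nilP s0E.
  by rewrite hE s0E word_prod_nil.
rewrite inE => /andP[pb nb]; have [y yW [i yE]] := root_conj (h^-1 b)%g.
exists y, (simple i); rewrite -yE permKV; split=> //; exact: affine_simple_simple.
Qed.

(** Walls reduce the claim for [(x, y)] to shorter distances as soon as one
    separates [x] from [y], with [y] on its negative side.  If there is none,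
    [x] and [y] are reflected together in a wall with [y], hence also [x], on
    its negative side; this keeps [y^-1 x] fixed, and connectivity leads to a
    position in which a separating wall exists. *)
Theorem unique_qwalk d x y p : x \in W -> y \in W -> qwalk x p y -> (size p <= d)%N ->
  unique_increasing_walk (fun (x : {perm root}) g => x * refl g)%g
    (@edge _ _ _ Phi) before d x y.
Proof.
elim: d x y p => [|d IHd] x y p xW yW wp lep.
  move: lep wp; rewrite leqn0 => /nilP -> /= /eqP <-.
  exists [::]; split=> //= q wq sq; apply: increasing_prod_neq1 => //.
    exact: qwalk_positive wq.
  by apply: (mulgI x); rewrite mulg1 -(qwalk_prod wq).
case: (eqVneq x y) => [<- | xy].
  exists [::]; split=> //= q wq sq; apply: increasing_prod_neq1 => //.
    exact: qwalk_positive wq.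
  by apply: (mulgI x); rewrite mulg1 -(qwalk_prod wq).
pose h := (y^-1 * x)%g.
have hW : h \in W by rewrite groupM ?groupV.
have h1 : h != 1%g.
  by apply: contra xy => /eqP h1; rewrite -(mulKVg y x) -/h h1 mulg1.
have [y' [a [y'W aff na pa]]] := separating_root hW h1.
have cross z b q : z \in W -> affine_simple b -> ~~ positive (z b) ->
    positive ((z * h)%g b) -> qwalk (z * h)%g q z -> (size q <= d.+1)%N ->
    unique_increasing_walk (fun (x : {perm root}) g => x * refl g)%g
      (@edge _ _ _ Phi) before d.+1 (z * h)%g z.
  move=> zW affb nb pb wq leq.
  have zhW : (z * h)%g \in W by rewrite groupM.
  have [wu sz] := walk_uncross (s_wall affb) zhW pb nb wq.
  apply/(unique_increasing_walk_cross (s_wall affb) d zhW pb nb).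
  apply: IHd wu _ => //; last by rewrite -ltnS -sz.
  by rewrite groupM ?root_perm_weyl.
have xE : x = (y * h)%g by rewrite mulKVg.
clearbody h; rewrite xE in wp *; clear xE x xW xy h1.
have /connectP[r er yE] := descend_connect yW y'W; rewrite yE in y'W na pa; clear yE.
elim: r y yW p wp lep er y'W na pa => [|z1 r IHr] z zW p wp lep /=.
  by move=> _ _ na pa; apply: (cross z a p) => //; rewrite permM.
case/andP=> /existsP[b /and3P[affb nb /eqP z1E]] er lW na pa.
case pb: (positive ((z * h)%g b)); first exact: (cross z b p).
have zhW : (z * h)%g \in W by rewrite groupM.
have bW := root_perm_weyl b.
set x1 := (refl b * (z * h))%g; have x1W : x1 \in W by rewrite groupM.
have px1 : positive (x1 b).
  by rewrite permM root_permE refl_self weyl_opp // positive_opp pb.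
have x1K : (refl b * x1)%g = (z * h)%g by rewrite root_permKl.
have w1 : qwalk x1 (pos_root (x1 b) :: p) z.
  have x1E := wall_act_eta (s_wall affb) x1W.
  by rewrite /= x1E x1K wp andbT; apply: (wall_cross (s_wall affb)).
have [q wq sz] := walk_cross_end (s_wall affb) zW px1 nb w1.
rewrite -x1K; apply/(unique_increasing_walk_cross (s_wall affb) d.+1 x1W px1 nb).
apply/(unique_increasing_walk_cross_end d.+1 (s_wall affb) zW px1 nb).
have -> : x1 = (z1 * h)%g by rewrite z1E -mulgA.
rewrite -z1E; apply: (IHr z1 _ q) => //.
- by rewrite z1E groupM.
- by rewrite z1E -mulgA.
by case: sz => <-.
Qed.

(** The bound in the definition of the distance is met, as the labels of an
    increasing walk are distinct positive roots. *)
Lemma increasing_qwalk x y : x \in W -> y \in W -> exists p,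
  [/\ qwalk x p y, sorted before p, size p = qbg_dist x y,
      forall q, qwalk x q y -> (qbg_dist x y <= size q)%N &
      forall q, qwalk x q y -> sorted before q -> q = p].
Proof.
move=> xW yW; pose P k := [exists q : k.-tuple root, qwalk x q y].
have Pw q : qwalk x q y -> P (size q).
  by move=> wq; apply/existsP; exists (in_tuple q).
have exP : exists k, P k by have [q /Pw] := qwalk_exists xW yW; exists (size q).
case: (ex_minnP exP) => k /existsP[q0 wq0] kmin.
have leq0 : (size q0 <= k)%N by rewrite size_tuple.
have [p [wp sp lep up]] := unique_qwalk xW yW wq0 leq0.
have szp : size p = k by apply/eqP; rewrite eqn_leq lep kmin ?Pw.
have distE : qbg_dist x y = k.
  apply: (bigminn_eq (P := fun k => [exists p : k.-tuple root, qbg_path x p y])).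
  - rewrite -szp; apply: leq_ltn_trans (card_invset_max (word_prod Phi s)).
    rewrite -lenE ?word_prod_weyl //; apply: leq_trans s_reduced.
    rewrite -(size_inv_seq Phi s); apply: size_subseq.
    exact: sorted_subseq (qwalk_positive wp) sp.
  - by apply/existsP; exists q0; rewrite qbg_pathE.
  by move=> l /existsP[q]; rewrite qbg_pathE // => /Pw; rewrite size_tuple; exact: kmin.
by exists p; rewrite distE; split=> // q /Pw; exact: kmin.
Qed.

Lemma qbg_dist_le x y p : x \in W -> qwalk x p y -> (qbg_dist x y <= size p)%N.
Proof.
move=> xW wp; have yW := qwalk_weyl xW wp.
by have [p0 [_ _ _ le _]] := increasing_qwalk xW yW; exact: le.
Qed.

Lemma qbg_dist_triangle x y z : x \in W -> y \in W -> z \in W ->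
  (qbg_dist x z <= qbg_dist x y + qbg_dist y z)%N.
Proof.
move=> xW yW zW.
have [p [wp _ <- _ _]] := increasing_qwalk xW yW.
have [q [wq _ <- _ _]] := increasing_qwalk yW zW.
by rewrite -size_cat; apply: qbg_dist_le; rewrite // walk_cat -(walk_end wp) wp.
Qed.

(** Suppose a shortest walk starts with [g], and let [d] be the first label of
    the increasing walk from there.  If [d] precedes [g], these two steps
    can be sorted into an increasing walk labelled [a1], [a2].  Here [a1]
    precedes [g]: otherwise [d], [g], [a1], [a2] would be an increasing
    sequence of reflections with product 1.  So [g] is not the least first
    label of a shortest walk. *)
Lemma increasing_first_label x y g p : x \in W -> y \in W -> edge x g ->
  qbg_dist x y = (qbg_dist (x * refl g)%g y).+1 -> qwalk x p y -> sorted before p ->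
  exists h p', p = h :: p' /\ ~~ before g h.
Proof.
move=> xW yW; have [m] := ubnP (index g (inv_seq Phi s)).
elim: m g => // m IHm g; rewrite ltnS => lem exg dE wp sp.
have [p0 [_ _ _ _ up]] := increasing_qwalk xW yW.
have zW : (x * refl g)%g \in W by rewrite groupM ?root_perm_weyl.
have [[|d q] [wq sq szq _ _]] := increasing_qwalk zW yW.
  exists g, [::]; rewrite before_irr; split=> //.
  by rewrite (up p) // (up [:: g]) //= exg.
have pg : positive g by case/andP: (edge_pos exg).
move: wq => /= /andP[ed wq]; have pd : positive d by case/andP: (edge_pos ed).
case: (boolP (before g d)) => [gd | ngd].
  exists g, (d :: q); rewrite before_irr; split=> //.
  rewrite (up p) // (up [:: g, d & q]) //=; first by rewrite exg ed.
  by rewrite gd.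
have gd : d != g.
  apply/eqP => e; rewrite e root_permKr in wq.
  by have := qbg_dist_le xW wq; rewrite dE -szq /= ltnNge leqnSn.
have {ngd}dg : before d g by have := before_total s_all pd pg gd; rewrite (negPf ngd) orbF.
set u := (x * refl g * refl d)%g in wq; have uW : u \in W by rewrite groupM ?root_perm_weyl.
have leu : (qbg_dist u y <= size q)%N by exact: qbg_dist_le.
have [p2 [wp2 sp2 sz2 _ _]] := increasing_qwalk xW uW.
have sz2E : size p2 = 2.
  apply/eqP; rewrite eqn_leq sz2; apply/andP; split.
    by apply: (qbg_dist_le (p := [:: g; d])); rewrite //= exg ed eqxx.
  have := qbg_dist_triangle xW uW yW; rewrite dE -szq /= => tri.
  by rewrite -(leq_add2r (size q)); apply: leq_trans tri _; rewrite leq_add2l.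
case: p2 wp2 sp2 sz2 sz2E => [|a1 [|a2 [|]]] // wp2 sp2 sz2 _.
have := qwalk_positive wp2; rewrite /= andbT => /andP[p1 p2].
have := qwalk_prod wp2; rewrite /u -mulgA big_cons big_seq1 => /mulgI prodE.
move: sp2; rewrite /= andbT => a12.
have ga1 : g != a1.
  apply/eqP => e; rewrite -e in prodE a12; move/mulgI: prodE.
  move/(root_perm_inj pd p2) => da2.
  by have := before_trans dg a12; rewrite da2 before_irr.
case: (boolP (before g a1)) => [ga | nga].
  have : [:: d; g; a1; a2] = [::]; last by [].
  apply: increasing_prod_neq1; rewrite /= ?pd ?pg ?p1 ?p2 ?dg ?ga ?a12 //.
  rewrite !big_cons big_nil mulg1 -prodE.
  by rewrite mulgA -[(refl d * refl g * _)%g]mulgA root_permKl root_permK.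
have a1g : before a1 g by have := before_total s_all pg p1 ga1; rewrite (negPf nga).
move: wp2 => /= /and3P[ea1 ea2 /eqP uE].
have z1W : (x * refl a1)%g \in W by rewrite groupM ?root_perm_weyl.
have d1 : qbg_dist x y = (qbg_dist (x * refl a1)%g y).+1.
  apply/eqP; rewrite eqn_leq; apply/andP; split.
    apply: leq_trans (qbg_dist_triangle xW z1W yW) _; rewrite -[leqRHS]add1n leq_add2r.
    by apply: (qbg_dist_le (p := [:: a1])); rewrite //= ea1 eqxx.
  rewrite dE -szq ltnS /=; apply: leq_trans (qbg_dist_triangle z1W uW yW) _.
  rewrite -add1n; apply: leq_add leu.
  by apply: (qbg_dist_le (p := [:: a2])); rewrite //= ea2 uE eqxx.
have [h [p' [pE nb]]] := IHm a1 (leq_trans a1g lem) ea1 d1 wp sp.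
exists h, p'; split=> //; apply: contra nb; exact: before_trans.
Qed.

End Reduced.
End UniqueWalks.

(** * The tilted order and the set [EQB] *)

Section Final.
Local Open Scope ring_scope.
Variables (R : realFieldType) (V : vectType R) (n : nat).
Variable Phi : root_system V n.
Local Notation root := (rootT Phi).
Local Notation co := (coord (simple_roots Phi)).
Local Notation simple := (simple_root Phi).
Local Notation W := (weyl Phi).
Local Notation refl a := (root_perm a).
Local Notation qwalk := (walk (fun (x : {perm root}) g => x * refl g)%g (@edge _ _ _ Phi)).
Implicit Types (g h : root) (i j : 'I_n) (x y z w : {perm root}) (s a b : seq 'I_n).

Lemma longestP : longest Phi \in W /\
  forall x, x \in W -> (len x <= len (longest Phi))%N.
Proof. by rewrite /longest; case: arg_maxnP => //=; exact: group1. Qed.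

Lemma longest_invset g : positive g -> g \in invset (longest Phi).
Proof.
have [w0W w0max] := longestP; set w0 := longest Phi in w0W w0max *.
move=> pg; rewrite inE pg /=; apply/negP => pc.
have neg i : ~~ positive (w0 (simple i)).
  apply/negP => pi; have siW : (refl (simple i) * w0)%g \in W.
    by rewrite groupM ?simple_weyl.
  by have := w0max _ siW; rewrite !lenE // invset_simple // pi ltnn.
have := pg; rewrite -(permKV w0 g) positive_ht ht_weyl // ltNge; case/negP.
apply: sumr_le0 => i _; rewrite mulr_ge0_le0 ?coord_pos_root // ltW //.
by rewrite -negative_ht.
Qed.

(** The list has as many entries as there are inversions, and contains all of
    them. *)
Lemma reduced_uniq s : size s = #|invset (word_prod Phi s)| ->
  uniq (inv_seq Phi s) /\ inv_seq Phi s =i invset (word_prod Phi s).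
Proof.
move=> sz; have sub : {subset enum (invset (word_prod Phi s)) <= inv_seq Phi s}.
  by move=> g; rewrite mem_enum inE => /andP[]; exact: inversion_in_word.
have le : (size (inv_seq Phi s) <= size (enum (invset (word_prod Phi s))))%N.
  by rewrite size_inv_seq sz cardE.
split; first exact: leq_size_uniq (enum_uniq _) sub le.
by move=> g; have [_ <-] := uniq_min_size (enum_uniq _) sub le; rewrite mem_enum.
Qed.

Lemma word_prod_foldl s g :
  foldl (fun h j => root_refl (simple j) h) g s = word_prod Phi s g.
Proof.
elim: s g => [|i s IHs] g /=; first by rewrite word_prod_nil perm1.
by rewrite IHs word_prod_cons permM root_permE.
Qed.

Lemma map_beta s : [seq beta Phi k | k <- enum 'I_(size s)] = inv_seq Phi s.
Proof.
elim: s => [|i s IHs]; first by rewrite enum_ord0.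
rewrite [inv_seq _ _]/= -IHs [size _]/= enum_ordSl /= -map_comp; congr (_ :: _).
  by rewrite /beta /= drop0 word_prod_foldl.
apply: eq_map => k; rewrite /= /beta !word_prod_foldl.
have -> : tnth (in_tuple (i :: s)) (lift ord0 k) = tnth (in_tuple s) k.
  by rewrite !(tnth_nth i).
by [].
Qed.

Lemma bruhat_lt_len x z : bruhat_lt x z -> (len x < len z)%N.
Proof.
case/andP=> ne /connectP[p]; elim: p x ne => [|y p IHp] x ne /=.
  by move=> _ xz; rewrite xz eqxx in ne.
case/andP=> /existsP[g /andP[_ lxy]] py zE.
case: (eqVneq y z) => [<- // | yz].
by apply: ltn_trans lxy _; exact: IHp.
Qed.

Variables (w : {perm root}) (a b : seq 'I_n).
Hypothesis hw : w \in W.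
Hypothesis hb : reduced_expr b w.
Hypothesis hab : reduced_expr (a ++ b) (longest Phi).
Local Notation s := (a ++ b).

Let wE : word_prod Phi b = w. Proof. by case/andP: hb => /eqP. Qed.

Lemma longest_word : [/\ uniq (inv_seq Phi s), forall g, (g \in inv_seq Phi s) = positive g &
  (size s <= len (word_prod Phi s))%N].
Proof.
case/andP: hab => /eqP e /eqP sz; have [|u m] := @reduced_uniq s.
  by rewrite e -lenE //; case: longestP.
split=> //; last by rewrite e sz.
move=> g; rewrite m e; apply/idP/idP; last exact: longest_invset.
by rewrite inE => /andP[].
Qed.

Let s_uniq : uniq (inv_seq Phi s). Proof. by have [] := longest_word. Qed.
Let s_all g : (g \in inv_seq Phi s) = positive g. Proof. by have [] := longest_word. Qed.
Let s_reduced : (size s <= len (word_prod Phi s))%N. Proof. by have [] := longest_word. Qed.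
Local Notation before := (@before R V n Phi s).

Lemma inv_seq_cat s1 s2 : exists2 l,
  inv_seq Phi (s1 ++ s2) = l ++ inv_seq Phi s2 & size l = size s1.
Proof.
elim: s1 => [|i s1 [l e sz]]; first by exists [::].
by exists (word_prod Phi (s1 ++ s2) (simple i) :: l); rewrite /= ?e ?sz.
Qed.

Lemma index_suffix g : g \in inv_seq Phi s ->
  (g \in inv_seq Phi b) = (size a <= index g (inv_seq Phi s))%N.
Proof.
have [l e sz] := inv_seq_cat a b; have := s_uniq.
rewrite e cat_uniq mem_cat index_cat -sz => /and3P[_ /hasPn nin _].
case gl: (g \in l) => /=; last by move=> ->; rewrite leq_addr.
move=> _; rewrite leqNgt index_mem gl /=; apply/negbTE/negP => /nin; by rewrite gl.
Qed.

Lemma suffix_upward g h : positive h -> g \in inv_seq Phi b -> before g h ->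
  h \in inv_seq Phi b.
Proof.
move=> ph gb gh; have [l e _] := inv_seq_cat a b.
have gs : g \in inv_seq Phi s by rewrite e mem_cat gb orbT.
rewrite index_suffix ?s_all //; rewrite index_suffix // in gb.
exact: leq_trans gb (ltnW gh).
Qed.

Lemma suffix_walk g p : all (@positive _ _ _ Phi) p -> path before g p ->
  g \in inv_seq Phi b -> all (mem (inv_seq Phi b)) p.
Proof.
elim: p g => //= h p IHp g /andP[ph pp] /andP[gh sp] gb.
have hb' := suffix_upward ph gb gh.
by rewrite hb' (IHp h).
Qed.

(** The path in the definition of [EQB] is the unique increasing walk, and its
    labels at positions in [b] are those in [inv_seq b]. *)
Lemma mem_EQB u p : u \in W -> qwalk w p u -> sorted before p ->
  (u \in EQB w a b) = all (mem (inv_seq Phi b)) p.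
Proof.
move=> uW wp sp.
have [p0 [_ _ sz0 _ up]] := increasing_qwalk s_uniq s_all s_reduced hw uW.
have pp0 := up p wp sp; rewrite -{}pp0 in sz0 up.
have idx (k : 'I_(size s)) : index (beta Phi k) (inv_seq Phi s) = k.
  have := index_uniq (beta Phi k) _ s_uniq; rewrite size_inv_seq => /(_ k (ltn_ord k)).
  by rewrite -{1}map_beta (nth_map k) ?size_enum_ord // nth_ord_enum.
rewrite inE uW /=; apply/existsP/idP => [[J /andP[/andP[wJ cJ] /forallP aJ]] | pb].
  rewrite qbg_pathE // in wJ.
  have sJ : sorted before [seq beta Phi k | k <- enum J].
    apply: (subseq_sorted (@before_trans _ _ _ Phi s)) (sorted_inv_seq s_uniq).
    by rewrite -map_beta map_subseq // enumT filter_subseq.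
  rewrite -(up _ wJ sJ); apply/allP => g /mapP[k]; rewrite mem_enum => kJ gE; rewrite gE.
  have := aJ k; rewrite kJ /= => ak.
  by rewrite index_suffix ?idx // -map_beta map_f // mem_enum.
pose J := [set k : 'I_(size s) | beta Phi k \in p].
have Jp : [seq beta Phi k | k <- enum J] = p.
  rewrite [RHS](sorted_filter_inv_seq s_uniq s_all (qwalk_positive wp) sp).
  rewrite -map_beta filter_map; congr map; rewrite enumT /enum_mem.
  by apply: eq_filter => k; rewrite /= !inE.
exists J; apply/andP; split.
  rewrite /label_increasing_shortest_path Jp qbg_pathE // wp /=.
  by rewrite cardE -(size_map (@beta _ _ _ Phi s)) Jp sz0.
apply/forallP => k; apply/implyP; rewrite inE => kp.
rewrite -[X in (_ <= X)%N]idx -index_suffix; first exact: (allP pb).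
by rewrite -map_beta map_f // mem_enum.
Qed.

(** The comparison of the increasing walks from [w] to [u] and from [w] to an
    element [z] above [w]. *)
Lemma EQB_tilted u : u \in W ->
  (u \in EQB w a b) = ~~ [exists z in W, bruhat_lt w z && tilted_le w z u].
Proof.
move=> uW; have [p [wp sp szp _ _]] := increasing_qwalk s_uniq s_all s_reduced hw uW.
have pos_p := qwalk_positive wp.
rewrite (mem_EQB uW wp sp); apply/idP/idP => [pb | ].
  apply/negP => /exists_inP[z zW /andP[wz /eqP tz]].
  have [r [wr sr szr _ _]] := increasing_qwalk s_uniq s_all s_reduced hw zW.
  have pos_r := qwalk_positive wr.
  (* or else [z] is spelled by a proper subword of [b] *)
  have nr : ~~ all (mem (inv_seq Phi b)) r.
    apply/negP => rb.
    have sub : subseq r (inv_seq Phi b).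
      have [l e _] := inv_seq_cat a b.
      rewrite (sorted_filter_inv_seq s_uniq s_all pos_r sr) e filter_cat.
      have := s_uniq; rewrite e cat_uniq => /and3P[_ /hasPn nin _].
      rewrite (eq_in_filter (a2 := pred0)) ?filter_pred0 ?filter_subseq // => g gl.
      apply/negbTE/negP => /(allP rb)/nin; by rewrite /= gl.
    have [s' s'E sz'] := deletion sub.
    have := bruhat_lt_len wz; rewrite (qwalk_prod wr) -wE s'E.
    rewrite ltnNge; case/negP; apply: leq_trans (len_word _ _) _.
    case/andP: hb => _ /eqP; rewrite -wE => <-.
    by rewrite -sz' leq_addr.
  case: r wr sr szr pos_r nr => [//|g r] wr sr szr pos_r nr.
  have pg : positive g by case/andP: pos_r.
  have gb : g \notin inv_seq Phi b.
    apply: contra nr => gb /=; rewrite gb; case/andP: pos_r => _ pr.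
    exact: suffix_walk pr sr gb.
  move: wr => /= /andP[eg wr].
  have z1W : (w * refl g)%g \in W by rewrite groupM ?root_perm_weyl.
  have d1 : qbg_dist w u = (qbg_dist (w * refl g)%g u).+1.
    apply/eqP; rewrite eqn_leq; apply/andP; split.
      apply: leq_trans (qbg_dist_triangle s_uniq s_all s_reduced hw z1W uW) _.
      rewrite -[leqRHS]add1n leq_add2r.
      apply: (qbg_dist_le s_uniq s_all s_reduced (p := [:: g])); rewrite //= eg eqxx //.
    rewrite tz -szr /= addSn ltnS.
    apply: leq_trans (qbg_dist_triangle s_uniq s_all s_reduced z1W zW uW) _.
    by rewrite leq_add2r; apply: (qbg_dist_le s_uniq s_all s_reduced).
  have [h [p' [pE nb]]] := increasing_first_label s_uniq s_all s_reduced hw uW eg d1 wp sp.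
  rewrite pE /= in pb pos_p; case/andP: pb => hinb _; case/andP: pos_p => ph _.
  have gh : g != h by apply: contraNneq gb => ->.
  have := before_total s_all pg ph gh; rewrite (negPf nb) /= => hg.
  by case/negP: gb; exact: suffix_upward pg hinb hg.
apply: contraR => npb; apply/exists_inP.
case: p wp sp szp pos_p npb => [//|h p] wp sp szp pos_p npb.
have ph : positive h by case/andP: pos_p.
have hnb : h \notin inv_seq Phi b.
  apply: contra npb => hinb /=; rewrite hinb; case/andP: pos_p => _ pr.
  exact: suffix_walk pr sp hinb.
move: wp => /= /andP[eh wp]; exists (w * refl h)%g; first by rewrite groupM ?root_perm_weyl.
have z1W : (w * refl h)%g \in W by rewrite groupM ?root_perm_weyl.
have up : positive (w^-1 h)%g.
  by apply: contraR hnb => np; apply: inversion_in_word; rewrite // wE.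
have lenz := edge_up eh up.
apply/andP; split.
  apply/andP; split.
    by apply/eqP => e; have := lenz; rewrite -e => /eqP; rewrite eqn_leq ltnn andbF.
  by apply: connect1; apply/existsP; exists h; rewrite eqxx lenz /=.
have l1 : (qbg_dist w (w * refl h)%g <= 1)%N.
  by apply: (qbg_dist_le s_uniq s_all s_reduced (p := [:: h])); rewrite //= eh eqxx.
have l2 : (qbg_dist (w * refl h)%g u <= size p)%N by exact: (qbg_dist_le s_uniq s_all s_reduced).
rewrite /tilted_le eqn_leq (qbg_dist_triangle s_uniq s_all s_reduced) //=.
by rewrite -szp /= -add1n leq_add.
Qed.

End Final.

Theorem lemma4p18 (R : realFieldType) (V : vectType R) (n : nat)
  (Phi : root_system V n) (w : {perm rootT Phi}) (hw : w \in weyl Phi)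
  (a b : seq 'I_n) (hb : reduced_expr b w)
  (hab : reduced_expr (a ++ b) (longest Phi)) :
  EQB w a b =
  [set u in weyl Phi |
     ~~ [exists z in weyl Phi, bruhat_lt w z && tilted_le w z u]].
Proof.
apply/setP => u; rewrite [in RHS]inE; case: (boolP (u \in weyl Phi)) => uW /=.
  exact: EQB_tilted.
by rewrite inE (negPf uW).
Qed.
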